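(* Let $N\ge1$ be an integer. There exists $s_0\in(\frac12,1)$ such that for every $s\in(s_0,1)$ both of the following hold, with $\mathcal I$ the operator of order $2s$ defined in the context. (i) (Interior regularity, which is the property characterizing the threshold $s_0$.) There is $\alpha=\alpha(s)\in(0,1)$ such that, for every domain $\Omega\subseteq\mathbb R^N$ and every $f\in C(\Omega)$, every bounded viscosity solution $u$ of $\mathcal Iu=f(x)$ in $\Omega$ belongs to $C^{0,\alpha}_{\mathrm{loc}}(\Omega)$, and for all open sets $\omega\subset\subset\omega'\subset\subset\Omega$ one has $\|u\|_{C^{0,\alpha}(\omega)}\le C$ with $C>0$ depending only on $s$, $\mathrm{dist}(\omega,\partial\omega')$, $\|u\|_{L^\infty(\mathbb R^N)}$ and $\|f\|_{L^\infty(\omega')}$. (ii) (Liouville property.) If $u\in C(\mathbb R^N)$ is a bounded viscosity solution of $\mathcal I u=0$ in $\mathbb R^N$, then $u$ is constant.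
   Context: $\mathbb S^{N-1}$ is the unit sphere of $\mathbb R^N$; $B_r(x)$ is the ball of radius $r$ centered at $x$; $A\subset\subset B$ means that $\overline A$ is compact and contained in $B$. For $u:\mathbb R^N\to\mathbb R$ put $\delta(u,x,y)=u(x+y)+u(x-y)-2u(x)$. For $s\in(0,1)$ and $\xi\in\mathbb S^{N-1}$, $$\mathcal I_\xi u(x)=C_s\int_0^{+\infty}\frac{\delta(u,x,\tau\xi)}{\tau^{1+2s}}\,d\tau,\qquad \mathcal I u(x)=\inf_{\xi\in\mathbb S^{N-1}}\mathcal I_\xi u(x)+\sup_{\xi\in\mathbb S^{N-1}}\mathcal I_\xi u(x),$$ where $C_s>0$ is a normalizing constant depending only on $s$ such that $\lim_{s\to1^-}\mathcal I_\xi u(x)=\langle D^2u(x)\xi,\xi\rangle$ for bounded smooth $u$. Viscosity solutions (standard definition): let $u:\mathbb R^N\to\mathbb R$ be bounded, Borel measurable and continuous in $\Omega$. $u$ is a viscosity subsolution (resp. supersolution) of $\mathcal Iu=f$ in $\Omega$ if for every $x_0\in\Omega$, every $\rho>0$ with $\overline{B_\rho(x_0)}\subset\Omega$ and every $\varphi\in C^2(\overline{B_\rho(x_0)})$ with $\varphi(x_0)=u(x_0)$ and $u\le\varphi$ (resp. $u\ge\varphi$) in $B_\rho(x_0)$, the function $\psi$ equal to $\varphi$ in $\overline{B_\rho(x_0)}$ and to $u$ elsewhere satisfies $\mathcal I\psi(x_0)\ge f(x_0)$ (resp. $\mathcal I\psi(x_0)\le f(x_0)$). A viscosity solution is a function that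 is both a subsolution and a supersolution. $\|u\|_{L^\infty(\mathbb R^N)}$ denotes $\sup_{\mathbb R^N}|u|$, and $\|u\|_{C^{0,\alpha}(\omega)}=\sup_\omega|u|+\sup_{x\ne y\in\omega}\frac{|u(x)-u(y)|}{|x-y|^\alpha}$. *)

(* Defs.v *)
From HB Require Import structures.
From mathcomp Require Export all_boot all_order all_algebra.
From mathcomp Require Export all_classical all_reals all_analysis.

Set Implicit Arguments.
Unset Strict Implicit.
Unset Printing Implicit Defensive.

Import Order.TTheory GRing.Theory Num.Theory.
Import numFieldNormedType.Exports.

Local Open Scope classical_set_scope.
Local Open Scope ring_scope.

Section Defs.
Context {R : realType} {N : nat}.
Implicit Types (u f phi : 'rV[R]_N -> R) (x y xi : 'rV[R]_N).
Implicit Types (A B U Omega omega : set 'rV[R]_N).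

(* R^N is 'rV[R]_N with its canonical (product) topology.                     *)
(* The library norm on 'rV[R]_N is the sup norm; the Euclidean one is needed. *)
Definition enorm x : R := Num.sqrt (\sum_(i < N) x 0 i ^+ 2).

Definition eball x (r : R) : set 'rV[R]_N := [set y | enorm (y - x) < r].

Definition usphere : set 'rV[R]_N := [set xi | enorm xi = 1].

Definition compactly_in A B := compact (closure A) /\ closure A `<=` B.

Definition bdry A : set 'rV[R]_N := closure A `\` interior A.

(* Equal to +oo when A or B is empty. *)
Definition set_dist A B : \bar R :=
  ereal_inf [set (enorm (p.1 - p.2))%:E | p in A `*` B].

Definition domain Omega := [/\ Omega !=set0, open Omega & connected Omega].

Definition supnorm A u : \bar R := ereal_sup [set `|u x|%:E | x in A].

Definition holder_norm (alpha : R) A u : \bar R :=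
  (supnorm A u +
   ereal_sup [set (`|u p.1 - u p.2| / enorm (p.1 - p.2) `^ alpha)%:E
             | p in [set p : 'rV[R]_N * 'rV[R]_N |
                     [/\ A p.1, A p.2 & p.1 != p.2]]])%E.

Definition holder_loc (alpha : R) Omega u :=
  forall omega, open omega -> compactly_in omega Omega ->
    (holder_norm alpha omega u < +oo)%E.

Definition bounded_on_space u := [bounded u x | x in [set: 'rV[R]_N]].

Definition borel_fun u :=
  measurable_fun setT (u : g_sigma_algebraType (@open 'rV[R]_N) -> R).

Definition partial (i : 'I_N) u : 'rV[R]_N -> R := 'D_(delta_mx 0 i) u.

Definition hess u x : 'M[R]_N := \matrix_(i, j) partial i (partial j u) x.

(* For U open: u is C^k in U and every partial derivative of order at most k  *)
(* extends continuously to the closure of U.                                  *)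
Fixpoint Ck_upto (k : nat) U u : Prop :=
  (exists g : 'rV[R]_N -> R,
     {within closure U, continuous g} /\ {in U, u =1 g}) /\
  (if k is k'.+1 then
     forall i : 'I_N, (forall x, U x -> derivable u x (delta_mx 0 i)) /\
               Ck_upto k' U (partial i u)
   else True).

(* C^k of the closure of the open set U, for a function whose values on the   *)
(* closure matter.                                                            *)
Definition Ck_closure (k : nat) U u :=
  {within closure U, continuous u} /\ Ck_upto k U u.

Definition smooth u := forall k, Ck_closure k setT u.

Definition delta u x y : R := u (x + y) + u (x - y) - 2 * u x.

Definition I_dir (C : R -> R) (s : R) xi u x : \bar R :=
  ((C s)%:E * \int[lebesgue_measure]_(tau in `]0%R, +oo[)
     (delta u x (tau *: xi) / tau `^ (1 + 2 * s))%:E)%E.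

Definition I_op (C : R -> R) (s : R) u x : \bar R :=
  (ereal_inf [set I_dir C s xi u x | xi in usphere] +
   ereal_sup [set I_dir C s xi u x | xi in usphere])%E.

Definition normalizing (C : R -> R) :=
  (forall s : R, 0 < s < 1 -> 0 < C s) /\
  (forall u x xi, bounded_on_space u -> smooth u -> usphere xi ->
     I_dir C s xi u x @[s --> 1^'-] --> ((xi *m hess u x *m xi^T) 0 0)%:E).

Definition visc_admissible Omega u :=
  [/\ bounded_on_space u, borel_fun u & {within Omega, continuous u}].

Definition visc_subsol (C : R -> R) (s : R) Omega f u :=
  visc_admissible Omega u /\
  forall x0 (rho : R) phi, Omega x0 -> 0 < rho ->
    closure (eball x0 rho) `<=` Omega ->
    Ck_closure 2 (eball x0 rho) phi -> phi x0 = u x0 ->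
    (forall x, eball x0 rho x -> u x <= phi x) ->
    ((f x0)%:E <= I_op C s (patch u (closure (eball x0 rho)) phi) x0)%E.

Definition visc_supersol (C : R -> R) (s : R) Omega f u :=
  visc_admissible Omega u /\
  forall x0 (rho : R) phi, Omega x0 -> 0 < rho ->
    closure (eball x0 rho) `<=` Omega ->
    Ck_closure 2 (eball x0 rho) phi -> phi x0 = u x0 ->
    (forall x, eball x0 rho x -> phi x <= u x) ->
    (I_op C s (patch u (closure (eball x0 rho)) phi) x0 <= (f x0)%:E)%E.

Definition visc_sol (C : R -> R) (s : R) Omega f u :=
  visc_subsol C s Omega f u /\ visc_supersol C s Omega f u.

End Defs.

Arguments usphere {R N}.
Arguments normalizing {R} N C.

(* Main.v *)
Require Import Defs.
From mathcomp Require Import measurable_realfun ring lra.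
(**
  The theorem is an Ishii-Lions argument with the exponent [alpha = 1/4].

  Double the variables: if [u x0 - u y > L |x0 - y| ^ (1/4)] for some [y], then
  [u x - u y - L |x - y| ^ (1/4) - psi x], with [psi] a truncated quadratic
  centred at [x0], has a positive maximum at some [(x, y)] with [x <> y] close to
  [x0]. Writing [T xi] and [S eta] for the directional integrals at [x] and [y],
  maximality gives
  [T xi - S eta <= L * (integral of the second differences of |.| ^ (1/4) at x - y
  in the direction xi - eta) + O(psi)].
  The operator is inf + sup, so the inf at [x] is paired with the sup at [y], and
  conversely. With [e] the direction of [x - y], [inf T - sup S] is at most
  [T e - S (- e)], where [xi - eta = 2 e] hits the strictly concave direction of
  the profile: as [s] tends to 1 this is worth [- 4 * (3/16)] against a factor
  [1 / (2 - 2 s)]. For [sup T - inf S] one may replace [eta] by [- eta], so that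
  [|xi - eta| ^ 2 <= 2], which costs at most [+ 1/2]. The total [- 1/4] dominates
  the tails, which stay bounded, once [s] is close to 1; this contradicts the
  equation when [L] is large.

  The resulting [L] is homogeneous in the size [rho] of the ball: it is a multiple
  of [M rho ^ (- 1/4) + F rho ^ (2 s - 1/4)] with [M] and [F] bounding [u] and
  [f]. Letting [rho] tend to infinity with [F = 0] yields the Liouville property.
*)

Set Implicit Arguments.
Unset Strict Implicit.
Unset Printing Implicit Defensive.

Import Order.TTheory GRing.Theory Num.Theory.
Import numFieldNormedType.Exports.

Local Open Scope classical_set_scope.
Local Open Scope ring_scope.

(** * The eighth root: concavity and expansion estimates *)

Section Root8.
Context {R : realType}.
Implicit Types p q r t v : R.

(* The profile |z| ^ (1/4) is [root8 (|z| ^ 2)]; as an iterated square root its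
   concavity estimates are polynomial inequalities. *)
Definition root8 q : R := Num.sqrt (Num.sqrt (Num.sqrt q)).

Lemma root8_ge0 q : 0 <= root8 q. Proof. exact: sqrtr_ge0. Qed.

Lemma root80 : root8 0 = 0. Proof. by rewrite /root8 !sqrtr0. Qed.

Lemma root8M p q : 0 <= p -> root8 (p * q) = root8 p * root8 q.
Proof. by move=> p0; rewrite /root8 sqrtrM// sqrtrM ?sqrtr_ge0// sqrtrM ?sqrtr_ge0. Qed.

Lemma continuous_root8 : continuous root8.
Proof.
move=> q; rewrite /root8.
apply: (@continuous_comp _ _ _ (fun q => Num.sqrt (Num.sqrt q)) (@Num.sqrt R));
  last exact: sqrt_continuous.
by apply: (@continuous_comp _ _ _ (@Num.sqrt R) (@Num.sqrt R)); exact: sqrt_continuous.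
Qed.

Lemma root8_powR q : 0 <= q -> root8 q = q `^ (8^-1).
Proof.
move=> q0; rewrite /root8 -powR12_sqrt ?sqrtr_ge0// -powR12_sqrt ?sqrtr_ge0//.
by rewrite -powR12_sqrt// -!powRrM; congr (_ `^ _); lra.
Qed.

Lemma root8_sqr_powR r : 0 <= r -> root8 (r ^+ 2) = r `^ (1 / 4).
Proof.
move=> r0; rewrite root8_powR ?sqr_ge0// -powR_mulrn// -powRrM.
by by congr (_ `^ _); lra.
Qed.

Lemma sqrtr_ge p q : 0 <= p -> p ^+ 2 <= q -> p <= Num.sqrt q.
Proof. by move=> p0 /ler_wsqrtr; rewrite sqrtr_sqr ger0_norm. Qed.

Lemma sqrtr_le p q : 0 <= p -> q <= p ^+ 2 -> Num.sqrt q <= p.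
Proof. by move=> p0 /ler_wsqrtr; rewrite sqrtr_sqr ger0_norm. Qed.

Lemma sqrtr_midpoint p q : 0 <= p -> 0 <= q ->
  Num.sqrt p + Num.sqrt q <= 2 * Num.sqrt ((p + q) / 2).
Proof.
move=> p0 q0.
have -> : p + q = Num.sqrt p ^+ 2 + Num.sqrt q ^+ 2 by rewrite !sqr_sqrtr.
have a0 := sqrtr_ge0 p; have b0 := sqrtr_ge0 q.
move: (Num.sqrt p) (Num.sqrt q) a0 b0 => a b a0 b0.
suff: (a + b) / 2 <= Num.sqrt ((a ^+ 2 + b ^+ 2) / 2) by lra.
by apply: sqrtr_ge; [lra|have := sqr_ge0 (a - b); nra].
Qed.

(** Midpoint concavity survives composition with the square root, which is increasing and
    concave. *)
Lemma root8_midpoint p q : 0 <= p -> 0 <= q ->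
  root8 p + root8 q <= 2 * root8 ((p + q) / 2).
Proof.
move=> p0 q0; rewrite /root8.
apply: le_trans (sqrtr_midpoint _ _) _; rewrite ?sqrtr_ge0//.
rewrite ler_pM2l//; apply: ler_wsqrtr.
have := sqrtr_midpoint (sqrtr_ge0 p) (sqrtr_ge0 q).
have H := sqrtr_midpoint p0 q0.
have H2 : Num.sqrt ((Num.sqrt p + Num.sqrt q) / 2) <= 
  Num.sqrt (Num.sqrt ((p + q) / 2)) by apply: ler_wsqrtr; lra.
lra.
Qed.

Lemma sqrtr1D_le t : -1 <= t -> Num.sqrt (1 + t) <= 1 + t / 2.
Proof. by move=> t0; apply: sqrtr_le; [lra|have := sqr_ge0 t; nra]. Qed.

Lemma root8_1D_le t : 0 <= t -> root8 (1 + t) <= 1 + t / 8.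
Proof.
move=> t0; rewrite /root8.
apply: (@le_trans _ _ (Num.sqrt (Num.sqrt (1 + t / 2)))).
  by do 2 apply: ler_wsqrtr; apply: sqrtr1D_le; lra.
apply: (@le_trans _ _ (Num.sqrt (1 + t / 2 / 2))).
  by apply: ler_wsqrtr; apply: sqrtr1D_le; lra.
by apply: le_trans (sqrtr1D_le _) _; lra.
Qed.

Lemma root8_le_sqrt q : 1 <= q -> root8 q <= Num.sqrt q.
Proof.
have H (v : R) : 1 <= v -> 1 <= Num.sqrt v <= v.
  by move=> v1; apply/andP; split; [apply: sqrtr_ge|apply: sqrtr_le]; nra.
move=> /H/andP[/H/andP[/H/andP[_ h3] h2] _]; exact: le_trans h3 h2.
Qed.

(** Linear growth is enough for large steps: divided by [t ^ (1 + 2 s)] it is integrable at infinity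
    when [s > 1/2]. *)
Lemma root8_1D_sqr_le t : 0 <= t -> root8 (1 + t ^+ 2) <= 1 + t.
Proof.
move=> t0; apply: le_trans (root8_le_sqrt _) _; first by have := sqr_ge0 t; lra.
by apply: sqrtr_le; nra.
Qed.

(* 3 / 16 = (1/4) * (1 - 1/4) is the sharp constant. *)
Lemma root8_sqr_midpoint t : 0 <= t <= 1 ->
  root8 ((1 + t) ^+ 2) + root8 ((1 - t) ^+ 2) <= 2 - 3 / 16 * t ^+ 2.
Proof.
move=> /andP[t0 t1].
rewrite /root8 !sqrtr_sqr !ger0_norm; [|lra|lra].
have tt : t ^+ 2 <= 1 by nra.
have t20 : 0 <= t ^+ 2 by exact: sqr_ge0.
(* The square has cancelled one root. For each of the two remaining layers, [p, q] and then [a, b],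
   a bound on the product gives a bound on the sum by squaring. *)
set p := Num.sqrt (1 + t); set q := Num.sqrt (1 - t).
have p0 : 0 <= p := sqrtr_ge0 _; have q0 : 0 <= q := sqrtr_ge0 _.
have p2 : p ^+ 2 = 1 + t by rewrite sqr_sqrtr; lra.
have q2 : q ^+ 2 = 1 - t by rewrite sqr_sqrtr; lra.
have pq : p * q = Num.sqrt (1 - t ^+ 2).
  by rewrite -sqrtrM; [congr Num.sqrt; ring|lra].
have pqle : p * q <= 1 - t ^+ 2 / 2.
  by rewrite pq; have := @sqrtr1D_le (- t ^+ 2); rewrite mulNr; apply; lra.
have pDq : p + q <= 2 - t ^+ 2 / 4.
  by rewrite -[leRHS]ger0_norm; [rewrite -ler_sqr ?nnegrE ?normr_ge0//; 
    [rewrite ger0_norm; nra|lra]|lra].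
set a := Num.sqrt p; set b := Num.sqrt q.
have a0 : 0 <= a := sqrtr_ge0 _; have b0 : 0 <= b := sqrtr_ge0 _.
have a2 : a ^+ 2 = p by rewrite sqr_sqrtr.
have b2 : b ^+ 2 = q by rewrite sqr_sqrtr.
have ab : a * b <= 1 - t ^+ 2 / 4.
  rewrite -sqrtrM//; apply: sqrtr_le; first lra.
  by apply: le_trans pqle _; nra.
have : (a + b) ^+ 2 <= (2 - 3 / 16 * t ^+ 2) ^+ 2.
  by rewrite sqrrD a2 b2; nra.
by rewrite ler_sqr ?nnegrE; [|lra|lra].
Qed.

(** With [v] the root, twice the gap factors as [(v - 1) ^ 2 * ((v + 1) ^ 2 - 1)]. *)
Lemma sqrtr1D_ge t : -1 <= t -> 1 + t / 2 - t ^+ 2 / 2 <= Num.sqrt (1 + t).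
Proof.
move=> t1; set v := Num.sqrt (1 + t).
have v0 : 0 <= v := sqrtr_ge0 _.
have v2 : v ^+ 2 = 1 + t by rewrite sqr_sqrtr; lra.
have -> : t = v ^+ 2 - 1 by lra.
have : 0 <= (v - 1) ^+ 2 * ((v + 1) ^+ 2 - 1) by rewrite mulr_ge0 ?sqr_ge0//; nra.
nra.
Qed.

Lemma sqrtr1D_dist t : -1 <= t -> (Num.sqrt (1 + t) - 1) ^+ 2 <= t ^+ 2.
Proof.
move=> t1; set v := Num.sqrt (1 + t).
have v0 : 0 <= v := sqrtr_ge0 _.
have v2 : v ^+ 2 = 1 + t by rewrite sqr_sqrtr; lra.
have -> : t = (v - 1) * (v + 1) by rewrite -subr_sqr_1; lra.
rewrite exprMn ler_peMr ?sqr_ge0//; nra.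
Qed.

(** The expansion is iterated through the three roots. By [sqrtr1D_dist] every quadratic error is at
    most a multiple of [t ^ 2], with weights 1/8, 1/4 and 1/2, whose sum is below one. *)
Lemma root8_1D_ge t : -1 <= t -> 1 + t / 8 - t ^+ 2 <= root8 (1 + t).
Proof.
move=> t1; rewrite /root8.
have := sqrtr1D_ge t1; have := sqrtr1D_dist t1.
have := sqrtr_ge0 (1 + t); move: (Num.sqrt (1 + t)) => v v0 d1 l1.
have v1 : -1 <= v - 1 by lra.
have := sqrtr1D_ge v1; have := sqrtr1D_dist v1; rewrite subrKC.
have := sqrtr_ge0 v; move: (Num.sqrt v) => w w0 d2 l2.
have w1 : -1 <= w - 1 by lra.
have := sqrtr1D_ge w1; rewrite subrKC; have := sqr_ge0 t; lra.
Qed.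

End Root8.

(** * Euclidean geometry of row vectors *)

Section Euclid.
Context {R : realType} {N : nat}.
Implicit Types x y z : 'rV[R]_N.

Definition dot x y : R := \sum_(i < N) x 0 i * y 0 i.
Definition sqn x : R := dot x x.

Lemma dotC x y : dot x y = dot y x.
Proof. by apply: eq_bigr => i _; rewrite mulrC. Qed.

Lemma dotDl x y z : dot (x + y) z = dot x z + dot y z.
Proof. by rewrite -big_split; apply: eq_bigr => i _; rewrite !mxE mulrDl. Qed.

Lemma dotZl (a : R) x y : dot (a *: x) y = a * dot x y.
Proof. by rewrite mulr_sumr; apply: eq_bigr => i _; rewrite !mxE mulrA. Qed.

Lemma dotDr x y z : dot z (x + y) = dot z x + dot z y.
Proof. by rewrite dotC dotDl !(dotC z). Qed.

Lemma dotZr (a : R) x y : dot y (a *: x) = a * dot y x.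
Proof. by rewrite dotC dotZl dotC. Qed.

Lemma dotNl x y : dot (- x) y = - dot x y.
Proof. by rewrite -scaleN1r dotZl mulN1r. Qed.

Lemma dotNr x y : dot x (- y) = - dot x y.
Proof. by rewrite dotC dotNl dotC. Qed.

Lemma sqn_ge0 x : 0 <= sqn x.
Proof. by apply: sumr_ge0 => i _; rewrite -expr2 sqr_ge0. Qed.

Lemma sqnD x y : sqn (x + y) = sqn x + 2 * dot x y + sqn y.
Proof. by rewrite /sqn !(dotDl, dotDr) (dotC y x); ring. Qed.

Lemma sqnB x y : sqn (x - y) = sqn x - 2 * dot x y + sqn y.
Proof. by rewrite sqnD dotNr /sqn dotNl dotNr; ring. Qed.

Lemma sqnZ (a : R) x : sqn (a *: x) = a ^+ 2 * sqn x.
Proof. by rewrite /sqn dotZl dotZr; ring. Qed.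

Lemma sqnN x : sqn (- x) = sqn x.
Proof. by rewrite /sqn dotNl dotNr opprK. Qed.

Lemma enormE x : enorm x = Num.sqrt (sqn x).
Proof. by congr Num.sqrt; apply: eq_bigr => i _; rewrite expr2. Qed.

Lemma sqn0 : sqn 0 = 0.
Proof. by rewrite /sqn /dot big1// => i _; rewrite mxE mul0r. Qed.

Lemma enorm0 : enorm (0 : 'rV[R]_N) = 0.
Proof. by rewrite enormE sqn0 sqrtr0. Qed.

Lemma enorm_ge0 x : 0 <= enorm x. Proof. exact: sqrtr_ge0. Qed.

Lemma enorm_sqr x : enorm x ^+ 2 = sqn x.
Proof. by rewrite enormE sqr_sqrtr ?sqn_ge0. Qed.

Lemma sqn_eq0 x : sqn x = 0 -> x = 0.
Proof.
move=> /eqP; rewrite psumr_eq0 => [/allP h|i _]; last by rewrite -expr2 sqr_ge0.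
apply/rowP => i; rewrite mxE; have := h i (mem_index_enum i).
by rewrite /= -expr2 sqrf_eq0 => /eqP.
Qed.

Lemma enorm_eq0 x : enorm x = 0 -> x = 0.
Proof. by move=> h; apply: sqn_eq0; rewrite -enorm_sqr h expr0n. Qed.

Lemma enorm_gt0 x : x != 0 -> 0 < enorm x.
Proof.
by move=> x0; rewrite lt_def enorm_ge0 andbT; apply: contra x0 => /eqP/enorm_eq0 ->.
Qed.

Lemma enormZ (a : R) x : enorm (a *: x) = `|a| * enorm x.
Proof. by rewrite !enormE sqnZ sqrtrM ?sqr_ge0// sqrtr_sqr. Qed.

Lemma enormN x : enorm (- x) = enorm x.
Proof. by rewrite !enormE sqnN. Qed.

Lemma enormB x y : enorm (x - y) = enorm (y - x).
Proof. by rewrite -enormN opprB. Qed.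

(** Cauchy-Schwarz, from the nonnegative squared norm of [sqn y *: x - dot x y *: y], a multiple of
    the part of [x] orthogonal to [y]. *)
Lemma dot_le x y : dot x y <= enorm x * enorm y.
Proof.
have [->|y0] := eqVneq y 0.
  by rewrite /dot big1 ?mulr_ge0 ?enorm_ge0// => i _; rewrite !mxE mulr0.
have ny := enorm_gt0 y0.
have [d0|/ltW d0] := leP (dot x y) 0.
  by apply: le_trans d0 _; rewrite mulr_ge0 ?enorm_ge0.
rewrite -ler_sqr ?nnegrE ?mulr_ge0 ?enorm_ge0//.
rewrite exprMn !enorm_sqr.
have : 0 <= sqn (sqn y *: x - dot x y *: y) := sqn_ge0 _.
rewrite sqnB !sqnZ dotZl dotZr.
have y20 : 0 < sqn y by rewrite -enorm_sqr exprn_gt0.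
have -> : sqn y ^+ 2 * sqn x - 2 * (sqn y * (dot x y * dot x y)) +
   dot x y ^+ 2 * sqn y = sqn y * (sqn x * sqn y - dot x y ^+ 2) by ring.
by rewrite pmulr_rge0// subr_ge0.
Qed.

Lemma ler_enormD x y : enorm (x + y) <= enorm x + enorm y.
Proof.
rewrite -ler_sqr ?nnegrE ?addr_ge0 ?enorm_ge0//.
by rewrite enorm_sqr sqnD sqrrD !enorm_sqr; have := dot_le x y; lra.
Qed.

Lemma ler_enorm_dist z x y : enorm (x - y) <= enorm (x - z) + enorm (z - y).
Proof. by have := ler_enormD (x - z) (z - y); rewrite addrA subrK. Qed.

Lemma ler_coord_enorm x i : `|x 0 i| <= enorm x.
Proof.
rewrite -ler_sqr ?nnegrE ?enorm_ge0// enorm_sqr real_normK ?num_real//.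
rewrite /sqn /dot (bigD1 i)//= -expr2 lerDl.
by apply: sumr_ge0 => j _; rewrite -expr2 sqr_ge0.
Qed.

Lemma continuous_sqn : continuous (sqn : 'rV[R]_N -> R).
Proof.
apply: continuous_big => [|i _ x]; first exact: add_continuous.
by apply: continuousM; exact: coord_continuous.
Qed.

Lemma continuous_enorm : continuous (@enorm R N).
Proof.
move=> x; have -> : @enorm R N = fun x => Num.sqrt (sqn x).
  by apply/funext => y; rewrite enormE.
apply: continuous_comp; [exact: continuous_sqn|exact: sqrt_continuous].
Qed.

Lemma continuous_enormB x : continuous (fun y => enorm (y - x)).
Proof.
move=> y; apply: (@continuous_comp _ _ _ (fun y => y - x)); last exact: continuous_enorm.
by apply: continuousB; [move=> A|exact: cst_continuous].
Qed.

Lemma open_eball x (r : R) : open (eball x r).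
Proof.
have -> : eball x r = (fun y => enorm (y - x)) @^-1` [set t | t < r] by [].
apply: open_comp; last exact: open_lt.
by move=> y _; exact: continuous_enormB.
Qed.

Lemma closed_cball x (r : R) : closed [set y | enorm (y - x) <= r].
Proof.
have -> : [set y | enorm (y - x) <= r] = 
  (fun y => enorm (y - x)) @^-1` [set t | t <= r] by [].
apply: closed_comp; last exact: closed_le.
by move=> y _; exact: continuous_enormB.
Qed.

Lemma closure_eball x (r : R) : closure (eball x r) `<=` [set y | enorm (y - x) <= r].
Proof.
rewrite [X in _ `<=` X]((closure_id _).1 (@closed_cball x r)).
by apply: closure_subset => y; exact: ltW.
Qed.

Lemma ler_norm_enorm x : `|x| <= enorm x.
Proof.
rewrite [leLHS]/Num.norm/= mx_normrE; apply: bigmax_le => [|[i j] _ /=].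
  exact: enorm_ge0.
by rewrite ord1; exact: ler_coord_enorm.
Qed.

(** Heine-Borel applies to the sup norm of the library, which the Euclidean norm dominates. *)
Lemma compact_cball x (r : R) : compact [set y | enorm (y - x) <= r].
Proof.
apply: bounded_closed_compact; last exact: closed_cball.
exists (`|x| + `|r|); split; first exact: num_real.
move=> M hM y /= hy; apply: le_trans (ltW hM).
rewrite -[y](subrK x) addrC; apply: le_trans (ler_normD _ _) _.
by rewrite lerD2l; apply: le_trans (ler_norm_enorm _) (le_trans hy (ler_norm _)).
Qed.
End Euclid.

(** * Integrals of truncated powers over the half-line *)

Section HalfLineIntegral.
Context {R : realType}.
Local Notation mu := (@lebesgue_measure R).
Local Notation D := (`]0%R, +oo[%classic : set R).
Implicit Types (f g : R -> R) (v w c b s t p : R).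

(** Integrability and a real value are bundled, so that combining and comparing integrals becomes
    real arithmetic. *)
Definition has_int f v :=
  mu.-integrable D (EFin \o f) /\ (\int[mu]_(t in D) (f t)%:E = v%:E)%E.

Lemma has_intD f g v w :
  has_int f v -> has_int g w -> has_int (fun t => f t + g t) (v + w).
Proof.
move=> [fi fv] [gi gw]; split; first exact: (integrableD _ fi gi).
by rewrite (integralD _ fi gi)// fv gw.
Qed.

Lemma has_intZ c f v : has_int f v -> has_int (fun t => c * f t) (c * v).
Proof.
move=> [fi fv]; split; first exact: (integrableZl _ _ fi).
by rewrite (integralZl _ fi)// fv.
Qed.

Lemma has_intB f g v w :
  has_int f v -> has_int g w -> has_int (fun t => f t - g t) (v - w).
Proof.
move=> fv /(has_intZ (-1)) gw; have := has_intD fv gw.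
by under eq_fun do rewrite mulN1r; rewrite mulN1r.
Qed.

Lemma has_int_le f g v w : (forall t, 0 < t -> f t <= g t) ->
  has_int f v -> has_int g w -> v <= w.
Proof.
move=> fg [fi fv] [gi gw]; rewrite -lee_fin -fv -gw.
apply: le_integral => // t; rewrite inE/= in_itv/= andbT => t0.
by rewrite lee_fin fg.
Qed.

Lemma has_int_dom f g w : measurable_fun D f ->
  (forall t, 0 < t -> `|f t| <= g t) -> has_int g w -> exists v, has_int f v.
Proof.
move=> mf fg [gi gw].
have fi : mu.-integrable D (EFin \o f).
  apply: le_integrable gi => //; first exact/measurable_EFinP.
  move=> t; rewrite /= in_itv/= andbT => t0.
  by rewrite lee_fin; apply: le_trans (fg _ t0) (ler_norm _).
exists (fine (\int[mu]_(t in D) (f t)%:E)); split => //.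
by rewrite fineK//; exact: integrable_fin_num fi.
Qed.

Lemma has_int_eq f g v : (forall t, 0 < t -> f t = g t) -> has_int f v ->
  has_int g v.
Proof.
move=> fg [fi fv]; split.
  apply: eq_integrable fi => // t; rewrite inE/= in_itv/= andbT => t0.
  by rewrite fg.
rewrite -fv; apply: eq_integral => t; rewrite inE/= in_itv/= andbT => t0.
by rewrite fg.
Qed.

(** For a nonnegative function the finite value already proves integrability; extension by zero
    brings all kernels to the common domain [D]. *)
Lemma has_int_ge0 f v (E : set R) : measurable E -> E `<=` D ->
  measurable_fun E f -> (forall t, E t -> 0 <= f t) ->
  (\int[mu]_(t in E) (f t)%:E = v%:E)%E -> has_int (f \_ E) v.
Proof.
move=> mE ED mf f0 fv.
have H : (\int[mu]_(t in D) ((f \_ E) t)%:E = v%:E)%E.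
  rewrite -fv [RHS]integral_mkcond [LHS]integral_mkcond.
  apply: eq_integral => t _; rewrite !patchE.
  case: (boolP (t \in E)) => tE; last by case: ifP.
  by rewrite ifT// mem_set//; apply: ED; exact/set_mem.
have mfE : measurable_fun D (EFin \o (f \_ E)).
  apply/measurable_EFinP/measurable_funTS.
  exact/(measurable_restrictT _ _).1.
split => //; apply/integrableP; split => //.
rewrite [ltLHS](_ : _ = v%:E) ?ltry// -H; apply: eq_integral.
move=> t _ /=; rewrite ger0_norm// patchE; case: ifPn => // tE.
by apply: f0; exact/set_mem.
Qed.

Lemma powR_is_derive c t : 0 < t ->
  is_derive t (1 : R) (fun t => t `^ c) (c * t `^ (c - 1)).
Proof.
move=> t0; have ti : t \in `]0, +oo[ by rewrite in_itv/= andbT.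
by apply: DeriveDef; [exact: derivable_powR|rewrite -derive1E powR_derive1].
Qed.

Lemma continuous_powR_gt0 c t : 0 < t -> {for t, continuous (fun t : R => t `^ c)}.
Proof.
move=> t0; apply/differentiable_continuous/derivable1_diffP.
by have [] := powR_is_derive c t0.
Qed.

Lemma powR_antiderivative c t : c != 0 -> 0 < t ->
  is_derive t (1 : R) (fun t => t `^ c / c) (t `^ (c - 1)).
Proof.
move=> c0 t0; have H := powR_is_derive c t0.
have -> : (fun t => t `^ c / c) = c^-1 \*: (fun t => t `^ c).
  by apply/funext => u; rewrite mulrC.
have := is_deriveZ c^-1 H; rewrite /GRing.scale/= mulrA mulVf// mul1r; exact.
Qed.

Lemma powR_cvgy0 c : c < 0 -> t `^ c @[t --> +oo%R] --> (0 : R).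
Proof.
move=> c0; apply/cvgr0Pnorm_lt => e e0.
have nc0 : 0 < - c by lra.
near=> t.
have t0 : 0 < t by near: t; exact: nbhs_pinfty_gt.
rewrite ger0_norm ?powR_ge0// -[c]opprK powRN invf_plt ?posrE ?powR_gt0//.
have -> : e^-1 = (e^-1 `^ (- c)^-1) `^ (- c).
  by rewrite -powRrM mulVf ?gt_eqF// powRr1 ?invr_ge0 ?ltW.
apply: gt0_ltr_powR => //; rewrite ?nnegrE ?powR_ge0 ?(ltW t0)//.
Unshelve. all: by end_near. Qed.

(** Divided by [t ^ (1 + 2 s)], a quadratic bound below [b] becomes [kin (1 - 2 s) b], and a linear
    bound from [b] on becomes [kout (- 2 s) b]. *)
Definition kin p b t : R := if t < b then t `^ p else 0.
Definition kout p b t : R := if t < b then 0 else t `^ p.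

Lemma has_int_kout p b : p < -1 -> 0 < b ->
  has_int (kout p b) (b `^ (p + 1) / (- (p + 1))).
Proof.
move=> p1 b0; set E := (`[b, +oo[%classic : set R).
have c0 : p + 1 != 0 by lra.
apply: (@has_int_eq ((fun t : R => t `^ p) \_ E)) => [t t0|].
  have tE : (t \in E) = (b <= t).
    by apply/idP/idP; rewrite inE /E/= in_itv/= andbT.
  by rewrite patchE tE /kout ltNge; case: (b <= t).
apply: has_int_ge0 => //.
- by rewrite /E; exact: measurable_itv.
- by move=> t; rewrite /E/= !in_itv/= !andbT; exact: lt_le_trans.
- by apply: measurable_funTS; exact: measurable_powR.
- by move=> t _; exact: powR_ge0.
rewrite (@ge0_continuous_FTC2y _ _ (fun t => t `^ (p + 1) / (p + 1)) _ 0).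
- by rewrite sub0e -EFinN; congr EFin; rewrite invrN mulrN.
- by move=> t _; exact: powR_ge0.
- apply: continuous_in_subspaceT => t; rewrite inE/= in_itv/= andbT => bt.
  by apply: continuous_powR_gt0; exact: lt_le_trans bt.
- rewrite -[X in _ --> X](mul0r (p + 1)^-1); apply: cvgM; last exact: cvg_cst.
  by apply: powR_cvgy0; lra.
- move=> t bt; have t0 : 0 < t by lra.
  by have [] := powR_antiderivative c0 t0.
- apply: cvg_at_right_filter.
  by apply: cvgM; [exact: continuous_powR_gt0|exact: cvg_cst].
- move=> t; rewrite in_itv/= andbT => bt; have t0 : 0 < t by lra.
  rewrite derive1E; have [_ ->] := powR_antiderivative c0 t0.
  by rewrite addrK.
Qed.

(** The power may blow up at 0, so the fundamental theorem is applied on intervals that stay away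
    from 0, and monotone convergence gives the limit. *)
Lemma has_int_kin p b : -1 < p -> 0 < b ->
  has_int (kin p b) (b `^ (p + 1) / (p + 1)).
Proof.
move=> p1 b0; set E := (`]0, b[%classic : set R).
have c0 : p + 1 != 0 by lra.
apply: (@has_int_eq ((fun t : R => t `^ p) \_ E)) => [t t0|].
  have tE : (t \in E) = (t < b).
    by apply/idP/idP; rewrite inE /E/= in_itv/= t0.
  by rewrite patchE tE /kin; case: (t < b).
apply: has_int_ge0 => //.
- by rewrite /E; exact: measurable_itv.
- by move=> t; rewrite /E/= !in_itv/= !andbT => /andP[].
- by apply: measurable_funTS; exact: measurable_powR.
- by move=> t _; exact: powR_ge0.
(* The index [n.+2] keeps [a 0] strictly below [b], so that no interval [F n] degenerates. *)
pose a n : R := b / n.+2%:R.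
have a0 n : 0 < a n by rewrite divr_gt0.
have ab n : a n < b by rewrite ltr_pdivrMr// ltr_pMr// ltr1n.
pose F n := (`[a n, b]%classic : set R).
have bigF : \bigcup_i F i = `]0, b]%classic.
  apply/seteqP; split => [t [n _]|t]; rewrite /F/= !in_itv/=.
    by move=> /andP[at_ ->]; rewrite (lt_le_trans (a0 n) at_).
  move=> /andP[t0 tb]; exists (Num.trunc (b / t)) => //.
  rewrite /= in_itv/= tb andbT /a ler_pdivrMr// mulrC -ler_pdivrMr//.
  have := truncnS_gt (b / t).
  move=> h; apply/ltW; apply: lt_trans h _; by rewrite ltr_nat.
have Fint n : (\int[mu]_(t in F n) (t `^ p)%:E =
    (b `^ (p + 1) / (p + 1) - a n `^ (p + 1) / (p + 1))%:E)%E.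
  rewrite (@continuous_FTC2 _ _ (fun t => t `^ (p + 1) / (p + 1))) ?EFinB//.
  - apply: continuous_in_subspaceT => t; rewrite inE/= in_itv/= => /andP[at_ _].
    by apply: continuous_powR_gt0; exact: lt_le_trans at_.
  - split.
    + move=> t; rewrite in_itv/= => /andP[at_ _].
      by have [] := powR_antiderivative c0 (lt_trans (a0 n) at_).
    + apply: cvg_at_right_filter.
      by apply: cvgM; [exact: continuous_powR_gt0|exact: cvg_cst].
    + apply: cvg_at_left_filter.
      by apply: cvgM; [exact: continuous_powR_gt0|exact: cvg_cst].
  - move=> t; rewrite in_itv/= => /andP[at_ _].
    rewrite derive1E; have [_ ->] := powR_antiderivative c0 (lt_trans (a0 n) at_).
    by rewrite addrK.
rewrite /E integral_itv_bndo_bndc; last first.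
  by apply/measurable_EFinP/measurable_funTS; exact: measurable_powR.
have H : (\int[mu]_(t in F i) (t `^ p)%:E)%E @[i --> \oo] -->
    (\int[mu]_(t in \bigcup_i F i) (t `^ p)%:E)%E.
  apply: ge0_nondecreasing_set_cvg_integral.
  - move=> m n mn; apply/subsetPset => t; rewrite /F/= !in_itv/= => /andP[h ->].
    rewrite andbT; apply: le_trans h; rewrite /a ler_pM2l// lef_pV2 ?posrE//.
    by rewrite ler_nat.
  - by move=> n; exact: measurable_itv.
  - by move=> n; apply/measurable_EFinP/measurable_funTS; exact: measurable_powR.
  - by move=> n t _; rewrite lee_fin powR_ge0.
rewrite bigF in H; apply: (cvg_unique _ H) => //.
have a_cvg : a @ \oo --> (b * 0 : R).
  apply: cvgM; first exact: cvg_cst.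
  by have := @cvg_harmonic R; rewrite -cvg_shiftS; apply.
have G : b `^ (p + 1) / (p + 1) - a n `^ (p + 1) / (p + 1) @[n --> \oo] -->
    b `^ (p + 1) / (p + 1) - 0 / (p + 1).
  apply: cvgB; first exact: cvg_cst.
  apply: cvgM; last exact: cvg_cst.
  have c1 : 0 < p + 1 by lra.
  have /cvg_at_rightP := powR_cvg0 c1; apply; split => //.
  by rewrite mulr0 in a_cvg.
rewrite mul0r subr0 in G.
apply: cvg_EFin; first by near=> n; rewrite Fint.
by apply: cvg_trans G; apply: near_eq_cvg; near=> n; rewrite /= Fint.
Unshelve. all: by end_near. Qed.

End HalfLineIntegral.

(** * Test functions and their regularity *)

Section TestFunctions.
Context {R : realType} {N : nat}.
Local Notation V := 'rV[R]_N.
Implicit Types (f g : V -> R) (x y z v w : V).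

(** Restriction to a line turns directional derivatives into derivatives in one variable, where the
    chain rule for real powers is available. *)
Lemma is_derive_line f x v d :
  is_derive x v f d <-> is_derive (0 : R) (1 : R) (fun h : R => f (h *: v + x)) d.
Proof.
have E : 'D_(1 : R) (fun h : R => f (h *: v + x)) 0 = 'D_v f x.
  rewrite /derive.
  set a := (X in lim (X @ _) = _); set b := (X in _ = lim (X @ _)).
  suff -> : a = b by []; apply/funext => h.
  by rewrite /a /b /= addr0 scale0r add0r [_%:A]mulr1.
split => -[df <-].
  by split; [exact/(derivable1P f x v)|rewrite E].
by split; [exact/(derivable1P f x v)|rewrite E].
Qed.

Lemma is_derive_powR_comp g x v d c : 0 < g x -> is_derive x v g d ->
  is_derive x v (fun z => g z `^ c) (c * g x `^ (c - 1) * d).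
Proof.
move=> g0 /is_derive_line dg; apply/is_derive_line.
pose gl := fun h : R => g (h *: v + x).
have gl0 : gl 0 = g x by rewrite /gl scale0r add0r.
have := @is_derive1_comp _ (fun t => t `^ c) gl 0 _ _ _ dg.
rewrite gl0; apply; exact: powR_is_derive.
Qed.

Lemma is_derive_coord x v i : is_derive x v (fun z => z 0 i) (v 0 i).
Proof.
apply/is_derive_line.
have -> : (fun h : R => (h *: v + x) 0 i) = (v 0 i \*: id) + cst (x 0 i).
  by apply/funext => h; rewrite !mxE mulrC.
have := is_deriveD (is_deriveZ (v 0 i) (is_derive_id (0 : R) 1))
  (is_derive_cst (x 0 i) (0 : R) 1).
by rewrite addr0 [_%:A]mulr1.
Qed.

Lemma is_derive_dotB x y v w : is_derive x v (fun z => dot (z - y) w) (dot v w).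
Proof.
have -> : (fun z => dot (z - y) w) =
    (\sum_(i < N) (w 0 i \*: (fun z => z 0 i))) - cst (dot y w).
  apply/funext => z; rewrite dotDl dotNl; congr (_ - _); rewrite fct_sumE.
  by apply: eq_bigr => i _; rewrite mulrC.
have -> : dot v w = (\sum_(i < N) w 0 i * v 0 i) - 0.
  by rewrite subr0; apply: eq_bigr => i _; rewrite mulrC.
apply: is_deriveB; apply: is_derive_sum => i.
exact: is_deriveZ (is_derive_coord _ _ _).
Qed.

Lemma is_derive_sqnB x y v :
  is_derive x v (fun z => sqn (z - y)) (2 * dot (x - y) v).
Proof.
have -> : (fun z => sqn (z - y)) =
    (\sum_(i < N) (((fun z => z 0 i) : V -> R) - cst (y 0 i)) ^+ 2).
  apply/funext => z; rewrite fct_sumE; apply: eq_bigr => i _.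
  by rewrite !mxE -expr2.
have -> : 2 * dot (x - y) v = \sum_(i < N) (2 * (x 0 i - y 0 i) ^+ 1) *: (v 0 i - 0).
  rewrite mulr_sumr; apply: eq_bigr => i _.
  by rewrite !mxE subr0 expr1 /GRing.scale/= mulrA.
apply: is_derive_sum => i; apply: is_deriveX.
by apply: is_deriveB; exact: is_derive_coord.
Qed.

Lemma for_continuousD f g x : {for x, continuous f} -> {for x, continuous g} ->
  {for x, continuous (fun z => f z + g z)}.
Proof. by move=> fx gx; exact: (@continuousD _ _ _ f g). Qed.

Lemma for_continuousM f g x : {for x, continuous f} -> {for x, continuous g} ->
  {for x, continuous (fun z => f z * g z)}.
Proof. by move=> fx gx; exact: (@continuousM _ _ f g). Qed.

Lemma for_continuousZ (k : R) f x : {for x, continuous f} ->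
  {for x, continuous (fun z => k * f z)}.
Proof. by move=> fx; apply: for_continuousM fx; exact: cst_continuous. Qed.

Lemma continuous_dotB y w : continuous (fun z => dot (z - y) w).
Proof.
move=> z; have -> : (fun z => dot (z - y) w) =
    (fun z => \sum_(i < N) w 0 i * z 0 i - dot y w).
  apply/funext => x; rewrite dotDl dotNl; congr (_ - _).
  by apply: eq_bigr => i _; rewrite mulrC.
apply: (@continuousB _ _ _ (fun z : V => \sum_(i < N) w 0 i * z 0 i) (cst _));
  last exact: cst_continuous.
apply: continuous_big => [|i _ x]; first exact: add_continuous.
by apply: continuousM; [exact: cst_continuous|exact: coord_continuous].
Qed.

Lemma continuous_sqnB y : continuous (fun z => sqn (z - y)).
Proof.
move=> z; apply: (@continuous_comp _ _ _ (fun z => z - y)); last exact: continuous_sqn.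
by apply: continuousB; [move=> A|exact: cst_continuous].
Qed.

Lemma continuous_powR_sqnB y c z : z != y ->
  {for z, continuous (fun z => sqn (z - y) `^ c)}.
Proof.
move=> zy; apply: (@continuous_comp _ _ _ (fun z => sqn (z - y)) (fun t => t `^ c)).
  exact: continuous_sqnB.
apply: continuous_powR_gt0; rewrite -enorm_sqr exprn_gt0// enorm_gt0//.
by rewrite subr_eq0.
Qed.

(** A criterion by explicit formulas: [df] and [d2f] supply the continuous extensions to the
    closure. As [U] is open, [partial i f] agrees with [df] near each of its points and can be
    differentiated through that formula. *)
Lemma Ck_upto2 (U : set V) f (df : V -> V -> R) (d2f : V -> V -> V -> R) :
  open U ->
  (forall x, closure U x -> {for x, continuous f}) ->
  (forall v x, closure U x -> {for x, continuous (df v)}) ->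
  (forall v w x, closure U x -> {for x, continuous (d2f v w)}) ->
  (forall v x, U x -> is_derive x v f (df v x)) ->
  (forall v w x, U x -> is_derive x w (df v) (d2f v w x)) ->
  Ck_closure 2 U f.
Proof.
move=> oU cf cdf cd2f fdf dfd2f.
have within g : (forall x, closure U x -> {for x, continuous g}) ->
    {within closure U, continuous g}.
  by move=> h; apply: continuous_in_subspaceT => x /set_mem; exact: h.
split; first exact: within.
have part1 i x : U x -> partial i f x = df (delta_mx 0 i) x.
  by move=> Ux; have [_] := fdf (delta_mx 0 i) x Ux.
have near1 i x : U x -> \forall z \near x, df (delta_mx 0 i) z = partial i f z.
  move=> Ux; near=> z; rewrite part1//; near: z; exact: open_nbhs_nbhs.
split; first by exists f; split => //; exact: within.
move=> i; split; first by move=> x /(fdf (delta_mx 0 i))[].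
split.
  exists (df (delta_mx 0 i)); split; first by apply: within => x; exact: cdf.
  by move=> x /set_mem; exact: part1.
have d2 j x : U x ->
    is_derive x (delta_mx 0 j) (partial i f) (d2f (delta_mx 0 i) (delta_mx 0 j) x).
  by move=> Ux; apply: near_eq_is_derive (near1 i x Ux) _; exact: dfd2f.
move=> j; split; first by move=> x /(d2 j)[].
split => //.
exists (d2f (delta_mx 0 i) (delta_mx 0 j)); split; first by apply: within => x; exact: cd2f.
by move=> x /set_mem /(d2 j)[_].
Unshelve. all: by end_near. Qed.

Definition quarter_test (c L A : R) y y' z : R :=
  c + L * root8 (sqn (z - y)) + A * sqn (z - y').

Lemma continuous_quarter_test c L A y y' : continuous (quarter_test c L A y y').
Proof.
move=> z; rewrite /quarter_test; apply: for_continuousD; last first.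
  by apply: for_continuousZ; exact: continuous_sqnB.
apply: for_continuousD; first exact: cst_continuous.
apply: for_continuousZ.
apply: (@continuous_comp _ _ _ (fun z => sqn (z - y))); first exact: continuous_sqnB.
exact: continuous_root8.
Qed.

(** The closed ball avoids the singularity [y], so there the profile is a power of a positive smooth
    function. *)
Lemma Ck_quarter_test c L A y y' x (rho : R) : rho < enorm (x - y) ->
  Ck_closure 2 (eball x rho) (quarter_test c L A y y').
Proof.
move=> rxy.
have nzy z : closure (eball x rho) z -> z != y.
  by move=> /closure_eball/= h; apply: contraTneq rxy => <-; rewrite -leNgt enormB.
pose q z := sqn (z - y).
have qgt0 z : closure (eball x rho) z -> 0 < q z.
  by move=> /nzy zy; rewrite /q -enorm_sqr exprn_gt0// enorm_gt0// subr_eq0.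
pose df v z := L * (8^-1 * q z `^ (8^-1 - 1) * (2 * dot (z - y) v)) +
  A * (2 * dot (z - y') v).
pose d2f v w z := L * (8^-1 * (((8^-1 - 1) * q z `^ (8^-1 - 1 - 1) *
   (2 * dot (z - y) w)) * (2 * dot (z - y) v) +
   q z `^ (8^-1 - 1) * (2 * dot w v))) + A * (2 * dot w v).
have testE : quarter_test c L A y y' =
    (cst c + L \*: (fun z => q z `^ 8^-1)) + A \*: (fun z => sqn (z - y')).
  by apply/funext => z; rewrite /quarter_test root8_powR ?sqn_ge0.
apply: (@Ck_upto2 _ _ df d2f); first exact: open_eball.
- by move=> z _; exact: continuous_quarter_test.
- move=> v z Uz; rewrite /df; apply: for_continuousD; apply: for_continuousZ.
    apply: for_continuousM.
      apply: for_continuousZ.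
      by apply: continuous_powR_sqnB; exact: nzy.
    by apply: for_continuousZ; exact: continuous_dotB.
  by apply: for_continuousZ; exact: continuous_dotB.
- move=> v w z Uz; rewrite /d2f; apply: for_continuousD; last exact: cst_continuous.
  apply: for_continuousZ.
  apply: for_continuousZ.
  apply: for_continuousD; last first.
    apply: for_continuousM; last exact: cst_continuous.
    by apply: continuous_powR_sqnB; exact: nzy.
  apply: for_continuousM; last first.
    by apply: for_continuousZ; exact: continuous_dotB.
  apply: for_continuousM; last first.
    by apply: for_continuousZ; exact: continuous_dotB.
  apply: for_continuousZ.
  by apply: continuous_powR_sqnB; exact: nzy.
- move=> v z /subset_closure Uz; rewrite testE.
  have -> : df v z = (0 + L *: (8^-1 * q z `^ (8^-1 - 1) * (2 * dot (z - y) v))) +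
     A *: (2 * dot (z - y') v) by rewrite add0r.
  apply: is_deriveD; last by apply: is_deriveZ; exact: is_derive_sqnB.
  apply: is_deriveD; apply: is_deriveZ.
  by apply: is_derive_powR_comp; [exact: qgt0|exact: is_derive_sqnB].
- move=> v w z /subset_closure Uz.
  have -> : df v = L \*: (8^-1 \*: ((fun z => q z `^ (8^-1 - 1)) *
      (2 \*: (fun z => dot (z - y) v)))) + A \*: (2 \*: (fun z => dot (z - y') v)).
    by apply/funext => u; rewrite /df -!mulrA.
  have -> : d2f v w z = L *: (8^-1 *: (q z `^ (8^-1 - 1) *: (2 *: dot w v) +
      (2 * dot (z - y) v) *: ((8^-1 - 1) * q z `^ (8^-1 - 1 - 1) * (2 * dot (z - y) w)))) +
      A *: (2 *: dot w v).
    by rewrite /d2f /GRing.scale/=; ring.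
  apply: is_deriveD; last by do 2 apply: is_deriveZ; exact: is_derive_dotB.
  do 2 apply: is_deriveZ; apply: is_deriveM.
    by apply: is_derive_powR_comp; [exact: qgt0|exact: is_derive_sqnB].
  by apply: is_deriveZ; exact: is_derive_dotB.
Qed.

End TestFunctions.

(** * Second differences of the profile and of the localization *)

Section DeltaEstimates.
Context {R : realType} {N : nat}.
Local Notation V := 'rV[R]_N.
Implicit Types (u : V -> R) (x y z v X : V) (r t c : R).

Definition quarter x : R := root8 (sqn x).

Lemma quarterN x : quarter (- x) = quarter x.
Proof. by rewrite /quarter sqnN. Qed.

Lemma quarter_powR x : quarter x = enorm x `^ (1 / 4).
Proof. by rewrite -root8_sqr_powR ?enorm_ge0// enorm_sqr. Qed.

Lemma deltaN u x v : delta u x (- v) = delta u x v.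
Proof. by rewrite /delta opprK (addrC (u (x - v))). Qed.

(** By the parallelogram identity the mean of [|X + v| ^ 2] and [|X - v| ^ 2] is
    [|X| ^ 2 + |v| ^ 2]; concavity of [root8] does the rest. *)
Lemma delta_quarter_root8 X v r : 0 < r -> enorm X = r ->
  delta quarter X v <= 2 * quarter X * (root8 (1 + sqn v / r ^+ 2) - 1).
Proof.
move=> r0 Xr; have r20 : 0 < r ^+ 2 by rewrite exprn_gt0.
have Xr2 : sqn X = r ^+ 2 by rewrite -enorm_sqr Xr.
have := root8_midpoint (sqn_ge0 (X + v)) (sqn_ge0 (X - v)).
rewrite sqnD sqnB; set m := (_ / 2).
have -> : m = sqn X * (1 + sqn v / r ^+ 2).
  by rewrite /m Xr2; field; rewrite gt_eqF.
rewrite root8M ?sqn_ge0// /delta /quarter -sqnD -sqnB; lra.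
Qed.

Lemma delta_quarter_le X v r : 0 < r -> enorm X = r ->
  delta quarter X v <= quarter X * (sqn v / r ^+ 2) / 4.
Proof.
move=> r0 Xr; apply: le_trans (delta_quarter_root8 v r0 Xr) _.
have t0 : 0 <= sqn v / r ^+ 2 by rewrite divr_ge0 ?sqn_ge0 ?sqr_ge0.
have := root8_1D_le t0; have : 0 <= quarter X := root8_ge0 _; nra.
Qed.

Lemma delta_quarter_le_enorm X v r : 0 < r -> enorm X = r ->
  delta quarter X v <= 2 * quarter X * (enorm v / r).
Proof.
move=> r0 Xr; apply: le_trans (delta_quarter_root8 v r0 Xr) _.
have t0 : 0 <= enorm v / r by rewrite divr_ge0 ?enorm_ge0// ltW.
have := root8_1D_sqr_le t0; rewrite exprMn exprVn enorm_sqr.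
have : 0 <= quarter X := root8_ge0 _; nra.
Qed.

(** The only negative estimate: along its own ray the profile is strictly concave. *)
Lemma delta_quarter_radial X c : 0 <= c <= 1 ->
  delta quarter X (c *: X) <= - (3 / 16 * c ^+ 2 * quarter X).
Proof.
move=> c01; rewrite /delta /quarter.
have -> : X + c *: X = (1 + c) *: X by rewrite scalerDl scale1r.
have -> : X - c *: X = (1 - c) *: X by rewrite scalerBl scale1r.
rewrite !sqnZ !(root8M _ (sqr_ge0 _)).
by have := ler_wpM2r (root8_ge0 (sqn X)) (root8_sqr_midpoint c01); lra.
Qed.

(** This lower bound serves to make the difference quotients of the test functions integrable at
    0. *)
Lemma delta_quarter_ge X v r : 0 < r -> enorm X = r -> enorm v <= r ->
  - (10 * quarter X * (sqn v / r ^+ 2)) <= delta quarter X v.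
Proof.
move=> r0 Xr vr; have r20 : 0 < r ^+ 2 by rewrite exprn_gt0.
have Xr2 : sqn X = r ^+ 2 by rewrite -enorm_sqr Xr.
have q0 : 0 <= quarter X := root8_ge0 _.
(* The two squared norms are [r ^ 2 * (1 + a + b)] and [r ^ 2 * (1 - a + b)]. First-order terms in
   [a] cancel, [a ^ 2 <= 4 * b] by Cauchy-Schwarz, and [b / 4 - 2 a ^ 2 - 2 b ^ 2 >= - 10 b]. *)
pose a := 2 * dot X v / r ^+ 2; pose b := sqn v / r ^+ 2.
have b0 : 0 <= b by rewrite divr_ge0 ?sqn_ge0 ?ltW.
have b1 : b <= 1.
  by rewrite ler_pdivrMr// mul1r -enorm_sqr ler_sqr ?nnegrE ?enorm_ge0// ltW.
have a2 : a ^+ 2 <= 4 * b.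
  have d2 : dot X v ^+ 2 <= r ^+ 2 * sqn v.
    have h1 := dot_le X v; have h2 := dot_le X (- v).
    rewrite dotNr enormN in h2; rewrite -enorm_sqr -Xr -exprMn.
    by move: (dot X v) (enorm X * enorm v) h1 h2 => p q h1 h2; nra.
  rewrite /a /b expr_div_n exprMn.
  rewrite ler_pdivrMr ?exprn_gt0//.
  have -> : 4 * (sqn v / r ^+ 2) * (r ^+ 2) ^+ 2 = 4 * (r ^+ 2 * sqn v).
    by field; rewrite gt_eqF.
  lra.
have plus : quarter (X + v) = quarter X * root8 (1 + (a + b)).
  rewrite /quarter -root8M ?sqn_ge0// sqnD Xr2 /a /b; congr root8.
  by field; rewrite gt_eqF.
have minus : quarter (X - v) = quarter X * root8 (1 + (- a + b)).
  rewrite /quarter -root8M ?sqn_ge0// sqnB Xr2 /a /b; congr root8.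
  by field; rewrite gt_eqF.
have pos1 : -1 <= a + b.
  have := sqn_ge0 (X + v); rewrite sqnD Xr2.
  have -> : r ^+ 2 + 2 * dot X v + sqn v = r ^+ 2 * (1 + (a + b)).
    by rewrite /a /b; field; rewrite gt_eqF.
  by rewrite pmulr_rge0//; lra.
have pos2 : -1 <= - a + b.
  have := sqn_ge0 (X - v); rewrite sqnB Xr2.
  have -> : r ^+ 2 - 2 * dot X v + sqn v = r ^+ 2 * (1 + (- a + b)).
    by rewrite /a /b; field; rewrite gt_eqF.
  by rewrite pmulr_rge0//; lra.
rewrite /delta plus minus -/b.
have h1 := root8_1D_ge pos1; have h2 := root8_1D_ge pos2.
have h : - (10 * b) <= root8 (1 + (a + b)) + root8 (1 + (- a + b)) - 2.
  have b2 : b ^+ 2 <= b by nra.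
  lra.
by have := ler_wpM2l q0 h; lra.
Qed.

Definition tquad (A rho : R) x0 z : R := A * Num.min (sqn (z - x0) / rho ^+ 2) 1.

Lemma tquad_ge0 A rho x0 z : 0 <= A -> 0 <= tquad A rho x0 z.
Proof.
move=> A0; rewrite mulr_ge0// le_min ler01 andbT.
by rewrite divr_ge0 ?sqn_ge0 ?sqr_ge0.
Qed.

Lemma tquad_le A rho x0 z : 0 <= A -> tquad A rho x0 z <= A / rho ^+ 2 * sqn (z - x0).
Proof.
move=> A0; rewrite -mulrA ler_wpM2l// [_^-1 * _]mulrC.
by rewrite ge_min lexx.
Qed.

Lemma tquad_le1 A rho x0 z : 0 <= A -> tquad A rho x0 z <= A.
Proof. by move=> A0; rewrite -[leRHS]mulr1 ler_wpM2l// ge_min lexx orbT. Qed.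

Lemma tquad_in A rho x0 z : 0 < rho -> enorm (z - x0) <= rho ->
  tquad A rho x0 z = A / rho ^+ 2 * sqn (z - x0).
Proof.
move=> r0 zr; rewrite /tquad min_l; first by rewrite mulrA mulrAC.
rewrite ler_pdivrMr ?exprn_gt0// mul1r -enorm_sqr.
by rewrite ler_sqr ?nnegrE ?enorm_ge0 ?(ltW r0).
Qed.

Lemma tquad_out A rho x0 z : 0 < rho -> rho <= enorm (z - x0) ->
  tquad A rho x0 z = A.
Proof.
move=> r0 zr; rewrite /tquad min_r ?mulr1//.
rewrite ler_pdivlMr ?exprn_gt0// mul1r -enorm_sqr.
by rewrite ler_sqr ?nnegrE ?enorm_ge0 ?(ltW r0).
Qed.

(** The quadratic bound holds because [tquad] lies below its quadratic and equals it at [x]; the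
    constant bound because [tquad] takes values between 0 and [A]. *)
Lemma delta_tquad_le A rho x0 x v : 0 <= A -> 0 < rho -> enorm (x - x0) <= rho ->
  delta (tquad A rho x0) x v <= 2 * A * Num.min (sqn v / rho ^+ 2) 1.
Proof.
move=> A0 r0 xr; rewrite minr_pMr; last lra.
rewrite le_min; apply/andP; split; rewrite /delta.
  have := tquad_le rho x0 (x + v) A0; have := tquad_le rho x0 (x - v) A0.
  rewrite (tquad_in A r0 xr).
  have -> : x + v - x0 = (x - x0) + v by rewrite addrAC.
  have -> : x - v - x0 = (x - x0) - v by rewrite addrAC.
  move: (x - x0) => w; rewrite (sqnD w v) (sqnB w v) => h1 h2.
  have -> : 2 * A * (sqn v / rho ^+ 2) = 2 * (A / rho ^+ 2 * sqn v) by ring.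
  lra.
have := tquad_le1 rho x0 (x + v) A0; have := tquad_le1 rho x0 (x - v) A0.
have := tquad_ge0 rho x0 x A0; lra.
Qed.

Lemma continuous_tquad A rho x0 : continuous (tquad A rho x0).
Proof.
move=> z; rewrite /tquad; apply: for_continuousZ.
apply: (@continuous_min _ _ (fun z => sqn (z - x0) / rho ^+ 2) (cst 1));
  last exact: cst_continuous.
apply: for_continuousM; [exact: continuous_sqnB|exact: cst_continuous].
Qed.

End DeltaEstimates.

(** * Directional integrals and the inf-sup comparison *)

Section DirectionalIntegrals.
Context {R : realType} {N : nat}.
Local Notation V := 'rV[R]_N.
Local Notation D := (`]0%R, +oo[%classic : set R).
Implicit Types (u p : V -> R) (x y v xi : V) (s t : R).

Lemma continuous_line x v : continuous (fun t : R => x + t *: v).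
Proof.
move=> t; apply: (@continuousD _ _ _ (cst x) (fun t : R => t *: v)).
  exact: cst_continuous.
exact: scalel_continuous.
Qed.

Lemma measurable_line u x v : borel_fun u ->
  measurable_fun [set: R] (fun t : R => u (x + t *: v)).
Proof.
move=> bu.
pose l t : g_sigma_algebraType (@open V) := x + t *: v.
suff ml : measurable_fun [set: R] l by exact: (measurableT_comp bu ml).
apply: (@measurability _ _ R (g_sigma_algebraType (@open V)) setT l (@open V)) => //.
move=> _ [B oB <-].
rewrite setTI; apply: open_measurable.
by apply: open_comp => // t _; exact: continuous_line.
Qed.

Lemma measurable_patch_line u phi (A : set V) x v : borel_fun u ->
  continuous phi -> closed A ->
  measurable_fun [set: R] (fun t : R => patch u A phi (x + t *: v)).
Proof.
move=> bu cphi cA.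
apply: measurable_fun_ifT; last exact: measurable_line.
  apply: (measurable_fun_bool true).
  rewrite setTI (_ : _ @^-1` _ = (fun t : R => x + t *: v) @^-1` A).
    apply: closed_measurable; apply: closed_comp => // t _.
    exact: continuous_line.
  by apply/seteqP; split => t /=; [move=> /set_mem|move=> /mem_set].
apply: continuous_measurable_fun => t.
by apply: continuous_comp; [exact: continuous_line|exact: cphi].
Qed.

Definition dquot s p x xi t : R := delta p x (t *: xi) / t `^ (1 + 2 * s).

Lemma measurable_dquot s p x xi :
  (forall v, measurable_fun [set: R] (fun t : R => p (x + t *: v))) ->
  measurable_fun D (dquot s p x xi).
Proof.
move=> mp; apply: measurable_funTS; rewrite /dquot /delta.
apply: measurable_funM; last first.
  under eq_fun do rewrite -powRN.
  exact: measurable_powR.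
apply: measurable_funB; last exact: measurable_cst.
apply: measurable_funD; first exact: mp.
by have := mp (- xi); under eq_fun do rewrite scalerN.
Qed.

Lemma powR_quad s t : 0 < t -> t ^+ 2 / t `^ (1 + 2 * s) = t `^ (1 - 2 * s).
Proof.
move=> t0; rewrite -powR_mulrn ?ltW// -powRB; last by rewrite (gt_eqF t0) implybT.
by congr (_ `^ _); lra.
Qed.

Lemma powR_lin s t : 0 < t -> t / t `^ (1 + 2 * s) = t `^ (- (2 * s)).
Proof.
move=> t0; rewrite -[X in X / _]powRr1 ?ltW// -powRB; last by rewrite (gt_eqF t0) implybT.
by congr (_ `^ _); lra.
Qed.

(** [s < 1] makes the quadratic part integrable at 0, and [s > 1/2] the linear part integrable at
    infinity. *)
Lemma dquot_has_int s p x xi (K M e : R) : 1 / 2 < s < 1 -> 0 < e ->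
  (forall v, measurable_fun [set: R] (fun t : R => p (x + t *: v))) ->
  (forall t, 0 < t -> t < e -> `|delta p x (t *: xi)| <= K * t ^+ 2) ->
  (forall t, e <= t -> `|delta p x (t *: xi)| <= M * t) ->
  exists w, has_int (dquot s p x xi) w.
Proof.
move=> /andP[s0 s1] e0 mp in_ out.
have p1 : -1 < 1 - 2 * s by lra.
have p2 : - (2 * s) < -1 by lra.
have ki := has_int_kin p1 e0; have ko := has_int_kout p2 e0.
apply: has_int_dom (measurable_dquot s xi mp) _ (has_intD (has_intZ K ki) (has_intZ M ko)).
move=> t t0; rewrite /dquot normrM [`|_^-1|]ger0_norm ?invr_ge0 ?powR_ge0//.
rewrite ler_pdivrMr ?powR_gt0// /kin /kout; case: ltP => te.
  rewrite mulr0 addr0 -powR_quad// -mulrA divfK ?gt_eqF ?powR_gt0//; exact: in_.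
rewrite mulr0 add0r -powR_lin// -mulrA divfK ?gt_eqF ?powR_gt0//; exact: out.
Qed.

Lemma I_dir_has_int (C : R -> R) s p x xi w : has_int (dquot s p x xi) w ->
  I_dir C s xi p x = (C s * w)%:E.
Proof. by move=> [_ h]; rewrite /I_dir h EFinM. Qed.

(* Pairing the infimum at one point with the supremum at the other is what
   lets the strictly concave direction e enter the comparison. *)
Lemma inf_sup_compare (T S : V -> R) (e : V) (f1 f2 Z : R) : usphere e ->
  (forall xi eta, usphere xi -> usphere eta -> T xi - S eta <= Z) ->
  (f1%:E <= ereal_inf [set (T xi)%:E | xi in usphere] +
            ereal_sup [set (T xi)%:E | xi in usphere])%E ->
  (ereal_inf [set (S xi)%:E | xi in usphere] +
   ereal_sup [set (S xi)%:E | xi in usphere] <= f2%:E)%E ->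
  f1 - f2 <= Z + (T e - S e).
Proof.
move=> se TS.
set iT := ereal_inf _; set sT := ereal_sup _.
set iS := ereal_inf _; set sS := ereal_sup _ => hT hS.
have iTe : (iT <= (T e)%:E)%E by apply: ereal_inf_lbound; exists e.
have sSe : ((S e)%:E <= sS)%E by apply: ereal_sup_ubound; exists e.
have sTub eta : usphere eta -> (sT <= (Z + S eta)%:E)%E.
  move=> he; apply: ge_ereal_sup => _ [xi hxi <-].
  by rewrite lee_fin; have := TS xi eta hxi he; lra.
have sTe : ((T e)%:E <= sT)%E by apply: ereal_sup_ubound; exists e.
(* [sT] lies between [T e] and [Z + S e]; being finite, it cancels when the two equations are
   subtracted. *)
have sTfin : sT \is a fin_num.
  rewrite fin_numE; apply/andP; split.
    by apply: contraTneq sTe => ->; rewrite -ltNge ltNyr.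
  by apply: contraTneq (sTub e se) => ->; rewrite -ltNge ltry.
have iSlb : ((fine sT - Z)%:E <= iS)%E.
  apply: le_ereal_inf_tmp => _ [eta he <-]; rewrite lee_fin.
  by have := sTub eta he; rewrite -[sT]fineK// lee_fin; lra.
have h1 : f1 <= T e + fine sT.
  rewrite -lee_fin EFinD fineK//; apply: le_trans hT _.
  by rewrite leeD2r.
have h2 : (fine sT - Z) + S e <= f2.
  by rewrite -lee_fin EFinD; apply: le_trans hS; exact: leeD.
lra.
Qed.

End DirectionalIntegrals.

(* The bound on the sum of the two paired differences is -(1/4) L q t^2 / r^2 for
   kap r < t < r / 2; inside kap r the test functions only give + L q t^2 / r^2,
   and beyond r / 2 linear growth is used. The terms in A come from the
   localization [tquad]. *)
Definition comparison_bound {R : realType} (L q r A rho s kap : R) : R :=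
  L * q / r ^+ 2 * (5 / 4 * ((kap * r) `^ (1 - 2 * s + 1) / (1 - 2 * s + 1)) -
    1 / 4 * ((r / 2) `^ (1 - 2 * s + 1) / (1 - 2 * s + 1))) +
  8 * (L * q) / r * ((r / 2) `^ (- (2 * s) + 1) / - (- (2 * s) + 1)) +
  (4 * A / rho ^+ 2 * (rho `^ (1 - 2 * s + 1) / (1 - 2 * s + 1)) +
   4 * A / rho * (rho `^ (- (2 * s) + 1) / - (- (2 * s) + 1))).

(** * Comparison at a maximum point of the doubled function *)

Section MaximumPoint.
Context {R : realType} {N : nat}.
Local Notation V := 'rV[R]_N.
Context (u : V -> R) (x0 x y : V) (L M A rho s kap : R).
Context (L0 : 0 <= L) (A0 : 0 <= A) (rho0 : 0 < rho) (uM : forall z, `|u z| <= M).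
Context (bu : borel_fun u) (xx0 : enorm (x - x0) <= rho) (xy : x != y).
Context (xyrho : enorm (x - y) <= rho) (s12 : 1 / 2 < s < 1) (kap01 : 0 < kap < 1 / 2).
Context (umax : forall x' y',
  u x' - u y' - L * quarter (x' - y') - tquad A rho x0 x' <=
  u x - u y - L * quarter (x - y) - tquad A rho x0 x).
Implicit Types (z v xi eta : V) (t : R).

Let r := enorm (x - y).
Let eps := kap * r / 2.
Let q := quarter (x - y).
(** Freezing [y] in the doubled function gives [phi1], touching [u] from above at [x]; freezing [x]
    gives [phi2], touching from below at [y]. The full quadratic replaces [tquad], being smooth,
    larger, and equal to it at [x]. *)
Let phi1 := quarter_test (u x - L * q - A / rho ^+ 2 * sqn (x - x0)) L (A / rho ^+ 2) y x0.
Let phi2 := quarter_test (u y + L * q) (- L) 0 x x0.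
Let p1 := patch u (closure (eball x eps)) phi1.
Let p2 := patch u (closure (eball y eps)) phi2.

Let r0 : 0 < r. Proof. by rewrite enorm_gt0// subr_eq0. Qed.
Let eps0 : 0 < eps.
Proof. by have /andP[k0 _] := kap01; rewrite /eps divr_gt0// mulr_gt0. Qed.
Let q0 : 0 <= q. Proof. exact: root8_ge0. Qed.
Let yxr : enorm (y - x) = r. Proof. by rewrite enormB. Qed.
Let qyx : quarter (y - x) = q. Proof. by rewrite -quarterN opprB. Qed.

Let phi1_ge z : u z <= phi1 z.
Proof.
have := umax z y; rewrite (tquad_in A rho0 xx0) -/q.
have := tquad_le rho x0 z A0; rewrite /phi1 /quarter_test -/(quarter _); lra.
Qed.

Let phi2_le z : phi2 z <= u z.
Proof.
have := umax x z; rewrite /phi2 /quarter_test -/(quarter _) -/q.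
have -> : quarter (z - x) = quarter (x - z) by rewrite -quarterN opprB.
lra.
Qed.

Let phi1x : phi1 x = u x.
Proof. rewrite /phi1 /quarter_test -/(quarter _) -/q; lra. Qed.

Let phi2y : phi2 y = u y.
Proof. rewrite /phi2 /quarter_test -/(quarter _) qyx; lra. Qed.

Let patch_cases w phi z (P : R -> Prop) : P (u z) -> P (phi z) ->
  P (patch u (closure (eball w eps)) phi z).
Proof. by move=> Pu Pphi; rewrite /patch; case: ifP. Qed.

Let patch_out w phi z : eps < enorm (z - w) ->
  patch u (closure (eball w eps)) phi z = u z.
Proof.
move=> zw; rewrite /patch; case: ifPn => // /set_mem /closure_eball/=.
by rewrite leNgt zw.
Qed.

Let patch_in w phi z : enorm (z - w) < eps ->
  patch u (closure (eball w eps)) phi z = phi z.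
Proof. by move=> zw; rewrite /patch mem_set//; exact: subset_closure. Qed.

Let p1_ge z : u z <= p1 z. Proof. exact: (@patch_cases x phi1 z (fun a => u z <= a)). Qed.
Let p1_le z : p1 z <= phi1 z. Proof. exact: (@patch_cases x phi1 z (fun a => a <= phi1 z)). Qed.
Let p2_ge z : phi2 z <= p2 z. Proof. exact: (@patch_cases y phi2 z (fun a => phi2 z <= a)). Qed.
Let p2_le z : p2 z <= u z. Proof. exact: (@patch_cases y phi2 z (fun a => a <= u z)). Qed.
Let p1x : p1 x = u x. Proof. exact: (@patch_cases x phi1 x (fun a => a = u x)). Qed.
Let p2y : p2 y = u y. Proof. exact: (@patch_cases y phi2 y (fun a => a = u y)). Qed.

Let step_enorm w xi t : usphere xi -> 0 <= t -> enorm (w + t *: xi - w) = t.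
Proof. by move=> xi1 t0; rewrite addrC addKr enormZ xi1 mulr1 ger0_norm. Qed.

Let stepN_enorm w xi t : usphere xi -> 0 <= t -> enorm (w - t *: xi - w) = t.
Proof. by move=> xi1 t0; rewrite addrC addKr enormN enormZ xi1 mulr1 ger0_norm. Qed.

Let sqn_step xi t : usphere xi -> sqn (t *: xi) = t ^+ 2.
Proof. by move=> xi1; rewrite sqnZ -enorm_sqr xi1 expr1n mulr1. Qed.

Let delta_out w phi xi t : patch u (closure (eball w eps)) phi w = u w ->
  usphere xi -> eps < t ->
  delta (patch u (closure (eball w eps)) phi) w (t *: xi) = delta u w (t *: xi).
Proof.
move=> pw xi1 et; have t0 : 0 <= t by exact: ltW (lt_trans eps0 et).
by rewrite /delta pw !patch_out ?step_enorm ?stepN_enorm.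
Qed.

Let delta_in w phi xi t : patch u (closure (eball w eps)) phi w = phi w ->
  usphere xi -> 0 <= t -> t < eps ->
  delta (patch u (closure (eball w eps)) phi) w (t *: xi) = delta phi w (t *: xi).
Proof.
move=> pw xi1 t0 et; rewrite /delta pw.
by rewrite (patch_in _ (z := w + _)) ?step_enorm// (patch_in _ (z := w - _)) ?stepN_enorm.
Qed.

Let delta_phi1 v : delta phi1 x v = L * delta quarter (x - y) v + 2 * (A / rho ^+ 2) * sqn v.
Proof.
rewrite /delta /phi1 /quarter_test -!/(quarter _).
rewrite ![x + v - _]addrAC ![x - v - _]addrAC (sqnD (x - x0) v) (sqnB (x - x0) v); ring.
Qed.

Let delta_phi2 v : delta phi2 y v = - (L * delta quarter (y - x) v).
Proof.
rewrite /delta /phi2 /quarter_test -!/(quarter _).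
rewrite ![y + v - _]addrAC ![y - v - _]addrAC; ring.
Qed.

Let delta_p1_le xi t : usphere xi -> delta p1 x (t *: xi) <=
  L * q * (t ^+ 2 / r ^+ 2) / 4 + 2 * (A / rho ^+ 2) * t ^+ 2.
Proof.
move=> xi1; apply: (@le_trans _ _ (delta phi1 x (t *: xi))).
  by rewrite /delta p1x phi1x; have := p1_le (x + t *: xi);
    have := p1_le (x - t *: xi); lra.
rewrite delta_phi1 sqn_step//.
have := ler_wpM2l L0 (delta_quarter_le (t *: xi) r0 (erefl r)).
by rewrite sqn_step// -/q; lra.
Qed.

Let delta_p2_ge xi t : usphere xi ->
  - (L * q * (t ^+ 2 / r ^+ 2) / 4) <= delta p2 y (t *: xi).
Proof.
move=> xi1; apply: (@le_trans _ _ (delta phi2 y (t *: xi))); last first.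
  by rewrite /delta p2y phi2y; have := p2_ge (y + t *: xi);
    have := p2_ge (y - t *: xi); lra.
rewrite delta_phi2.
have := ler_wpM2l L0 (delta_quarter_le (t *: xi) r0 yxr).
by rewrite sqn_step// qyx; lra.
Qed.

Let delta_u w v : - (4 * M) <= delta u w v <= 4 * M.
Proof.
rewrite /delta; have := uM (w + v); have := uM (w - v); have := uM w.
rewrite !ler_norml => /andP[? ?] /andP[? ?] /andP[? ?]; apply/andP; split; lra.
Qed.

Let M0 : 0 <= M. Proof. exact: le_trans (normr_ge0 _) (uM x). Qed.

Let eps_r : eps <= r.
Proof. by rewrite /eps; have /andP[k0 k1] := kap01; have := r0; nra. Qed.

Let far_bound t : eps <= t -> 4 * M <= 4 * M / eps ^+ 2 * t ^+ 2.
Proof.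
move=> et; rewrite mulrAC ler_pdivlMr ?exprn_gt0// ler_wpM2l ?mulr_ge0//.
by rewrite ler_sqr ?nnegrE ?(ltW eps0)//; apply: le_trans et; exact: ltW.
Qed.

Let far_bound1 t : 2 * eps <= t -> 4 * M <= 4 * M / eps * t.
Proof.
move=> et; rewrite mulrAC ler_pdivlMr// ler_wpM2l ?mulr_ge0//.
by apply: le_trans et; have := eps0; lra.
Qed.

Let mp1 v : measurable_fun [set: R] (fun t : R => p1 (x + t *: v)).
Proof.
by apply: measurable_patch_line => //; [exact: continuous_quarter_test|exact: closed_closure].
Qed.

Let mp2 v : measurable_fun [set: R] (fun t : R => p2 (y + t *: v)).
Proof.
by apply: measurable_patch_line => //; [exact: continuous_quarter_test|exact: closed_closure].
Qed.

Let tr2 t : 0 <= t ^+ 2 / r ^+ 2. Proof. by rewrite divr_ge0 ?sqr_ge0. Qed.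

Let p1_int xi : usphere xi -> exists w, has_int (dquot s p1 x xi) w.
Proof.
move=> xi1; have e20 : 0 < 2 * eps by have := eps0; lra.
(* The cut is [2 * eps] because [delta_out] needs steps strictly beyond [eps]; between [eps] and
   [2 * eps] the term in [M] gives the lower bound, through [u <= p1]. *)
apply: (@dquot_has_int _ _ s p1 x xi
  (10 * (L * q) / r ^+ 2 + 2 * (A / rho ^+ 2) + 4 * M / eps ^+ 2)
  (4 * M / eps) (2 * eps)) => // t.
- move=> t0 te; rewrite ler_norml.
  have a0 : 0 <= 2 * (A / rho ^+ 2) * t ^+ 2.
    by apply: mulr_ge0; [apply: mulr_ge0 => //; exact: divr_ge0 (sqr_ge0 _)|exact: sqr_ge0].
  have m0 : 0 <= 4 * M / eps ^+ 2 * t ^+ 2.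
    by apply: mulr_ge0; [apply: divr_ge0 (sqr_ge0 _); exact: mulr_ge0|exact: sqr_ge0].
  have l0 : 0 <= L * q * (t ^+ 2 / r ^+ 2) by apply: mulr_ge0; [exact: mulr_ge0|exact: tr2].
  have E : (10 * (L * q) / r ^+ 2 + 2 * (A / rho ^+ 2) + 4 * M / eps ^+ 2) * t ^+ 2 =
    10 * (L * q * (t ^+ 2 / r ^+ 2)) + 2 * (A / rho ^+ 2) * t ^+ 2 +
    4 * M / eps ^+ 2 * t ^+ 2 by ring.
  rewrite E; apply/andP; split; last first.
    by apply: le_trans (delta_p1_le t xi1) _; lra.
  have [et|te'] := leP eps t.
    have /andP[du _] := delta_u x (t *: xi).
    have fb := far_bound et.
    have : delta u x (t *: xi) <= delta p1 x (t *: xi).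
      by rewrite /delta p1x; have := p1_ge (x + t *: xi);
        have := p1_ge (x - t *: xi); lra.
    lra.
  rewrite delta_in ?(ltW t0)//; last by rewrite phi1x.
  rewrite delta_phi1 sqn_step//.
  have tr : enorm (t *: xi) <= r.
    by rewrite enormZ xi1 mulr1 gtr0_norm// (le_trans (ltW te') eps_r).
  have := ler_wpM2l L0 (delta_quarter_ge r0 (erefl r) tr).
  by rewrite sqn_step// -/q; lra.
- move=> et; rewrite delta_out//; last by have := eps0; lra.
  apply: le_trans (far_bound1 et); rewrite ler_norml; exact: delta_u.
Qed.

Let p2_int xi : usphere xi -> exists w, has_int (dquot s p2 y xi) w.
Proof.
move=> xi1; have e20 : 0 < 2 * eps by have := eps0; lra.
apply: (@dquot_has_int _ _ s p2 y xi
  (10 * (L * q) / r ^+ 2 + 4 * M / eps ^+ 2) (4 * M / eps) (2 * eps)) => // t.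
- move=> t0 te; rewrite ler_norml.
  have m0 : 0 <= 4 * M / eps ^+ 2 * t ^+ 2.
    by apply: mulr_ge0; [apply: divr_ge0 (sqr_ge0 _); exact: mulr_ge0|exact: sqr_ge0].
  have l0 : 0 <= L * q * (t ^+ 2 / r ^+ 2) by apply: mulr_ge0; [exact: mulr_ge0|exact: tr2].
  have E : (10 * (L * q) / r ^+ 2 + 4 * M / eps ^+ 2) * t ^+ 2 =
    10 * (L * q * (t ^+ 2 / r ^+ 2)) + 4 * M / eps ^+ 2 * t ^+ 2 by ring.
  rewrite E; apply/andP; split.
    by apply: le_trans (delta_p2_ge t xi1); lra.
  have [et|te'] := leP eps t.
    have /andP[_ du] := delta_u y (t *: xi).
    have fb := far_bound et.
    have : delta p2 y (t *: xi) <= delta u y (t *: xi).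
      by rewrite /delta p2y; have := p2_le (y + t *: xi);
        have := p2_le (y - t *: xi); lra.
    lra.
  rewrite delta_in ?(ltW t0)//; last by rewrite phi2y.
  rewrite delta_phi2.
  have tr : enorm (t *: xi) <= r.
    by rewrite enormZ xi1 mulr1 gtr0_norm// (le_trans (ltW te') eps_r).
  have := ler_wpM2l L0 (delta_quarter_ge r0 yxr tr).
  by rewrite sqn_step// qyx; lra.
- move=> et; rewrite delta_out//; last by have := eps0; lra.
  apply: le_trans (far_bound1 et); rewrite ler_norml; exact: delta_u.
Qed.

(** Both points are displaced at once in [umax], forwards and backwards; the sum of the two
    inequalities is one between second differences. *)
Let pair_out xi eta t : usphere xi -> usphere eta -> eps < t ->
  delta p1 x (t *: xi) - delta p2 y (t *: eta) <=
  L * delta quarter (x - y) (t *: (xi - eta)) +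
  2 * A * Num.min (t ^+ 2 / rho ^+ 2) 1.
Proof.
move=> xi1 eta1 et; rewrite !delta_out//.
have := delta_tquad_le (t *: xi) A0 rho0 xx0; rewrite sqn_step//.
have := umax (x + t *: xi) (y + t *: eta); have := umax (x - t *: xi) (y - t *: eta).
have -> : x + t *: xi - (y + t *: eta) = x - y + t *: (xi - eta).
  by rewrite scalerBr opprD addrACA.
have -> : x - t *: xi - (y - t *: eta) = x - y - t *: (xi - eta).
  by rewrite scalerBr opprD opprB opprK addrACA addrC [t *: eta - _]addrC addrC.
rewrite /delta; lra.
Qed.

Let e := r^-1 *: (x - y).

Let e1 : usphere e.
Proof.
by rewrite /usphere/= enormZ -/r ger0_norm ?invr_ge0 ?(ltW r0)// mulVf ?gt_eqF.
Qed.

(** Second differences are even in the step, so [e] becomes [- e] at [y] and the relative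
    displacement is [2 * t] along [x - y]. *)
Let e_pair t : eps < t -> delta p1 x (t *: e) - delta p2 y (t *: e) <=
  L * delta quarter (x - y) ((2 * t / r) *: (x - y)) +
  2 * A * Num.min (t ^+ 2 / rho ^+ 2) 1.
Proof.
move=> et; rewrite -[delta p2 _ _]deltaN -scalerN.
have ne1 : usphere (- e) by rewrite /usphere/= enormN.
apply: le_trans (pair_out e1 ne1 et) _.
suff -> : t *: (e - - e) = (2 * t / r) *: (x - y) by [].
rewrite opprK -mulr2n -scaler_nat /e !scalerA; congr (_ *: _).
by rewrite mulrA [t * _]mulrC.
Qed.

Let pair_sum xi eta t : usphere xi -> usphere eta -> 0 <= dot xi eta -> 0 < t ->
  (delta p1 x (t *: e) - delta p2 y (t *: e)) +
  (delta p1 x (t *: xi) - delta p2 y (t *: eta)) <=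
  L * q / r ^+ 2 * (5 / 4 * (if t < kap * r then t ^+ 2 else 0) -
    1 / 4 * (if t < r / 2 then t ^+ 2 else 0)) +
  8 * (L * q) / r * (if t < r / 2 then 0 else t) +
  (4 * A / rho ^+ 2 * (if t < rho then t ^+ 2 else 0) +
   4 * A / rho * (if t < rho then 0 else t)).
Proof.
move=> xi1 eta1 dxe t0.
have /andP[k0 k1] := kap01.
have Lq0 : 0 <= L * q by exact: mulr_ge0.
have X0 : 0 <= L * q * (t ^+ 2 / r ^+ 2) by apply: mulr_ge0 => //; exact: tr2.
have [te|et] := leP t eps.
  have tk : t < kap * r.
    by apply: le_lt_trans te _; rewrite /eps ltr_pdivrMr// ltr_pMr ?mulr_gt0// ltr1n.
  have tr : t < r / 2 by apply: lt_trans tk _; have := r0; nra.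
  have trho : t < rho by have := r0; have : r <= rho := xyrho; lra.
  rewrite tk tr trho.
  (* Four test function bounds, each with coefficient 1/4, add up to one, which is [5/4 - 1/4] on
     the right-hand side. *)
  have := delta_p1_le t e1; have := delta_p1_le t xi1.
  have := delta_p2_ge t e1; have := delta_p2_ge t eta1.
  have -> : L * q / r ^+ 2 * (5 / 4 * t ^+ 2 - 1 / 4 * t ^+ 2) =
    L * q * (t ^+ 2 / r ^+ 2) by field; rewrite gt_eqF.
  have -> : 4 * A / rho ^+ 2 * t ^+ 2 = 4 * (A / rho ^+ 2 * t ^+ 2) by ring.
  have -> : 2 * (A / rho ^+ 2) * t ^+ 2 = 2 * (A / rho ^+ 2 * t ^+ 2) by ring.
  lra.
have xe2 : sqn (xi - eta) <= 2.
  by rewrite sqnB -!enorm_sqr xi1 eta1; lra.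
(* Below [r / 2] the radial gain [- 3/4] meets a cost of at most 1/2, since [|xi - eta| ^ 2 <= 2].
   From [r / 2] on, [2 * t / r] leaves the range of the radial estimate and each term is bounded
   linearly, with constant 4. *)
have main : L * delta quarter (x - y) ((2 * t / r) *: (x - y)) +
    L * delta quarter (x - y) (t *: (xi - eta)) <=
    - (1 / 4) * (L * q / r ^+ 2 * (if t < r / 2 then t ^+ 2 else 0)) +
    8 * (L * q) / r * (if t < r / 2 then 0 else t).
  case: ltP => tr.
    have c01 : 0 <= 2 * t / r <= 1.
      rewrite divr_ge0 ?mulr_ge0 ?(ltW t0) ?(ltW r0)//=.
      by rewrite ler_pdivrMr//; lra.
    have g1 := ler_wpM2l L0 (delta_quarter_radial (x - y) c01).
    have g2 := ler_wpM2l L0 (delta_quarter_le (t *: (xi - eta)) r0 (erefl r)).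
    have g3 : L * (quarter (x - y) * (sqn (t *: (xi - eta)) / r ^+ 2) / 4) <=
        1 / 2 * (L * q * (t ^+ 2 / r ^+ 2)).
      rewrite sqnZ -/q.
      have -> : L * (q * (t ^+ 2 * sqn (xi - eta) / r ^+ 2) / 4) =
        L * q * (t ^+ 2 / r ^+ 2) * (sqn (xi - eta) / 4) by ring.
      by rewrite [leRHS]mulrC ler_wpM2l//; clear g1 g2; lra.
    have g4 : L * - (3 / 16 * (2 * t / r) ^+ 2 * quarter (x - y)) =
      - (3 / 4) * (L * q * (t ^+ 2 / r ^+ 2)).
      by rewrite -/q; field; rewrite gt_eqF.
    have -> : L * q / r ^+ 2 * t ^+ 2 = L * q * (t ^+ 2 / r ^+ 2) by ring.
    rewrite mulr0 addr0; apply: le_trans (lerD g1 (le_trans g2 g3)) _.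
    by rewrite g4 -mulrDl (_ : - (3 / 4) + 1 / 2 = - (1 / 4) :> R)//; field.
  have g1 := ler_wpM2l L0 (delta_quarter_le_enorm ((2 * t / r) *: (x - y)) r0 (erefl r)).
  have g2 := ler_wpM2l L0 (delta_quarter_le_enorm (t *: (xi - eta)) r0 (erefl r)).
  have n1 : enorm ((2 * t / r) *: (x - y)) = 2 * t.
    rewrite enormZ -/r ger0_norm ?divfK ?gt_eqF//.
    by rewrite divr_ge0 ?mulr_ge0 ?(ltW t0) ?(ltW r0).
  have n2 : enorm (t *: (xi - eta)) <= 2 * t.
    rewrite enormZ (gtr0_norm t0) mulrC ler_wpM2r ?(ltW t0)//.
    by rewrite -ler_sqr ?nnegrE ?enorm_ge0// enorm_sqr; clear g1 g2; lra.
  have g3 : L * (2 * quarter (x - y) * (enorm (t *: (xi - eta)) / r)) <=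
      4 * (L * q * (t / r)).
    rewrite -/q.
    have -> : L * (2 * q * (enorm (t *: (xi - eta)) / r)) =
      L * q / r * (2 * enorm (t *: (xi - eta))) by ring.
    have -> : 4 * (L * q * (t / r)) = L * q / r * (2 * (2 * t)) by ring.
    by rewrite ler_wpM2l ?divr_ge0 ?(ltW r0)//; clear g1 g2; lra.
  have g4 : L * (2 * quarter (x - y) * (enorm ((2 * t / r) *: (x - y)) / r)) =
      4 * (L * q * (t / r)) by rewrite n1 -/q; ring.
  have -> : 8 * (L * q) / r * t = 8 * (L * q * (t / r)) by ring.
  rewrite mulr0 mulr0 add0r; apply: le_trans (lerD g1 (le_trans g2 g3)) _.
  by rewrite g4 -mulrDl (_ : 4 + 4 = 8 :> R)//; ring.
have minle : 4 * A * Num.min (t ^+ 2 / rho ^+ 2) 1 <=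
    4 * A / rho ^+ 2 * (if t < rho then t ^+ 2 else 0) +
    4 * A / rho * (if t < rho then 0 else t).
  have A40 : 0 <= 4 * A by rewrite mulr_ge0.
  case: ltP => trho.
    by rewrite mulr0 addr0 -[leRHS]mulrA ler_wpM2l// [leRHS]mulrC ge_min lexx.
  rewrite mulr0 add0r -[leRHS]mulrA ler_wpM2l//.
  apply: (@le_trans _ _ 1); first by rewrite ge_min lexx orbT.
  by rewrite mulrC ler_pdivlMr// mul1r.
have k5 : 0 <= L * q / r ^+ 2 * (5 / 4 * (if t < kap * r then t ^+ 2 else 0)).
  rewrite mulr_ge0 ?divr_ge0 ?sqr_ge0// mulr_ge0//.
  by case: ifP => // _; exact: sqr_ge0.
have h1 := e_pair et; have h2 := pair_out xi1 eta1 et.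
apply: le_trans (lerD h1 h2) _; rewrite addrACA; apply: lerD; last first.
  suff <- : 4 * A * Num.min (t ^+ 2 / rho ^+ 2) 1 =
    2 * A * Num.min (t ^+ 2 / rho ^+ 2) 1 + 2 * A * Num.min (t ^+ 2 / rho ^+ 2) 1 by [].
  by ring.
apply: le_trans main _; rewrite lerD2r mulrBr.
have -> : L * q / r ^+ 2 * (1 / 4 * (if t < r / 2 then t ^+ 2 else 0)) =
  1 / 4 * (L * q / r ^+ 2 * (if t < r / 2 then t ^+ 2 else 0)) by rewrite mulrCA.
by rewrite mulNr lerDr.
Qed.

Let T xi := fine (\int[lebesgue_measure]_(t in `]0%R, +oo[) (dquot s p1 x xi t)%:E).
Let S xi := fine (\int[lebesgue_measure]_(t in `]0%R, +oo[) (dquot s p2 y xi t)%:E).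

Let T_int xi : usphere xi -> has_int (dquot s p1 x xi) (T xi).
Proof. by move=> /p1_int[w [i iw]]; rewrite /T iw; split. Qed.

Let S_int xi : usphere xi -> has_int (dquot s p2 y xi) (S xi).
Proof. by move=> /p2_int[w [i iw]]; rewrite /S iw; split. Qed.

Let SN xi : S (- xi) = S xi.
Proof.
rewrite /S; congr fine; apply: eq_integral => t _.
by rewrite /dquot scalerN deltaN.
Qed.

Let pair_total_acute xi eta : usphere xi -> usphere eta -> 0 <= dot xi eta ->
  (T e - S e) + (T xi - S eta) <= comparison_bound L q r A rho s kap.
Proof.
move=> xi1 eta1 dxe.
have /andP[s0 s1] := s12; have /andP[k0 k1] := kap01.
have a1 : -1 < 1 - 2 * s by lra.
have a2 : - (2 * s) < -1 by lra.
have kr0 : 0 < kap * r by exact: mulr_gt0.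
have r20 : 0 < r / 2 by exact: divr_gt0.
have lhs := has_intD (has_intB (T_int e1) (S_int e1))
  (has_intB (T_int xi1) (S_int eta1)).
have rhs := has_intD (has_intD
   (has_intZ (L * q / r ^+ 2)
     (has_intB (has_intZ (5 / 4) (has_int_kin a1 kr0))
               (has_intZ (1 / 4) (has_int_kin a1 r20))))
   (has_intZ (8 * (L * q) / r) (has_int_kout a2 r20)))
  (has_intD (has_intZ (4 * A / rho ^+ 2) (has_int_kin a1 rho0))
            (has_intZ (4 * A / rho) (has_int_kout a2 rho0))).
apply: (has_int_le _ lhs rhs) => t t0.
have W0 : 0 < t `^ (1 + 2 * s) by exact: powR_gt0.
have kinE b : kin (1 - 2 * s) b t = (if t < b then t ^+ 2 else 0) / t `^ (1 + 2 * s).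
  by rewrite /kin; case: ifP; rewrite ?powR_quad ?mul0r.
have koutE b : kout (- (2 * s)) b t = (if t < b then 0 else t) / t `^ (1 + 2 * s).
  by rewrite /kout; case: ifP; rewrite ?powR_lin ?mul0r.
rewrite !kinE !koutE /dquot.
have := pair_sum xi1 eta1 dxe t0.
have Vi0 : 0 <= (t `^ (1 + 2 * s))^-1 by rewrite invr_ge0 ltW.
move=> /(ler_wpM2r Vi0); lra.
Qed.

(** For an obtuse angle, [eta] is replaced by [- eta], which leaves [S] unchanged. *)
Let pair_total xi eta : usphere xi -> usphere eta ->
  (T e - S e) + (T xi - S eta) <= comparison_bound L q r A rho s kap.
Proof.
move=> xi1 eta1; have [d0|/ltW d0] := leP 0 (dot xi eta).
  exact: pair_total_acute.
have eta1' : usphere (- eta) by rewrite /usphere/= enormN.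
have d1 : 0 <= dot xi (- eta) by rewrite dotNr oppr_ge0.
exact: (eq_ind _ (fun a => (T e - S e) + (T xi - a) <= comparison_bound L q r A rho s kap)
  (pair_total_acute xi1 eta1' d1) _ (SN eta)).
Qed.

(** The subsolution property is tested at [x] with [phi1], the supersolution property at [y] with
    [phi2], on balls of radius [eps < r], which miss the singularities. *)
Lemma maximum_point_comparison (C : R -> R) (Omega : set V) (f : V -> R) :
  0 < C s -> visc_sol C s Omega f u ->
  [set z | enorm (z - x) < r] `<=` Omega -> [set z | enorm (z - y) < r] `<=` Omega ->
  f x - f y <= C s * comparison_bound L q r A rho s kap.
Proof.
move=> Cs0 [[_ sub] [_ sup]] Ox Oy.
have epsr : eps < r by rewrite /eps; have /andP[? ?] := kap01; have := r0; nra.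
have clo (w : V) : closure (eball w eps) `<=` [set z | enorm (z - w) < r].
  by move=> z /closure_eball/= zw; exact: le_lt_trans zw epsr.
have self z : enorm (z - z) < r by rewrite subrr enorm0.
have epsr' : eps < enorm (y - x) by rewrite yxr.
have hT := sub x eps phi1 (Ox x (self x)) eps0 (subset_trans (clo x) Ox)
  (Ck_quarter_test _ _ _ _ epsr) phi1x (fun z _ => phi1_ge z).
have hS := sup y eps phi2 (Oy y (self y)) eps0 (subset_trans (clo y) Oy)
  (Ck_quarter_test _ _ _ _ epsr') phi2y (fun z _ => phi2_le z).
move: hS hT; rewrite -/p1 -/p2 /I_op.
have -> : [set I_dir C s xi p1 x | xi in usphere] =
    [set (C s * T xi)%:E | xi in usphere].
  by apply: eq_imagel => xi xi1; rewrite (I_dir_has_int C (T_int xi1)).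
have -> : [set I_dir C s xi p2 y | xi in usphere] =
    [set (C s * S xi)%:E | xi in usphere].
  by apply: eq_imagel => xi xi1; rewrite (I_dir_has_int C (S_int xi1)).
move=> hS hT.
(* [Z] is the bound minus the contribution of [e], so that adding this contribution back leaves the
   bound itself. *)
have := @inf_sup_compare _ _ (fun xi => C s * T xi) (fun xi => C s * S xi) e
  (f x) (f y) (C s * comparison_bound L q r A rho s kap - (C s * T e - C s * S e)) e1 _ hT hS.
rewrite subrK; apply => xi eta xi1 eta1.
have := ler_wpM2l (ltW Cs0) (pair_total xi1 eta1); lra.
Qed.

End MaximumPoint.

(** * The pointwise Holder bound *)

Section HolderBound.
Context {R : realType} {N : nat}.
Local Notation V := 'rV[R]_N.

Lemma ler_powR_npos (a b c : R) : 0 < a -> a <= b -> c <= 0 -> b `^ c <= a `^ c.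
Proof.
move=> a0 ab c0; have b0 : 0 < b by exact: lt_le_trans ab.
rewrite -[c]opprK (powRN b) (powRN a) lef_pV2 ?posrE ?powR_gt0//.
by apply: ge0_ler_powR; rewrite ?nnegrE ?oppr_ge0 ?(ltW a0) ?(ltW b0).
Qed.

(** The integral over the half-line of the minimum of [t ^ 2] and [t], divided by
    [t ^ (1 + 2 s)]. *)
Definition tail_const (s : R) : R := (2 - 2 * s)^-1 + (2 * s - 1)^-1.

(** This [kap] satisfies [kap ^ (2 - 2 s) = 1/20], so the inner cost 5/4 shrinks to 1/16, while the
    gain 1/4 keeps at least half its size. *)
Lemma comparison_bound_le (L q r A rho s : R) : 0 <= L * q -> 0 < r -> 0 < rho ->
  1 - 1 / (32 * 64) < s < 1 ->
  comparison_bound L q r A rho s ((1 / 20) `^ (2 - 2 * s)^-1) <=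
  - (L * q * r `^ (- (2 * s))) + 4 * A * rho `^ (- (2 * s)) * tail_const s.
Proof.
move=> Lq0 r0 rho0 /andP[s0 s1].
pose b := 2 - 2 * s; pose c := 2 * s - 1.
have b0 : 0 < b by rewrite /b; lra.
have c0 : 0 < c by rewrite /c; lra.
have E1 : 1 - 2 * s + 1 = b by rewrite /b; lra.
have E2 : - (2 * s) + 1 = - c by rewrite /c; lra.
have quad_scale t : 0 < t -> t `^ b = t `^ (- (2 * s)) * t ^+ 2.
  move=> t0; rewrite -[t ^+ 2]powR_mulrn ?(ltW t0)// -powRD;
    last by rewrite (gt_eqF t0) implybT.
  by congr (_ `^ _); rewrite /b; lra.
have lin_scale t : 0 < t -> t `^ (- c) = t `^ (- (2 * s)) * t.
  move=> t0; rewrite -[X in _ * X]powRr1 ?(ltW t0)// -powRD;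
    last by rewrite (gt_eqF t0) implybT.
  by congr (_ `^ _); rewrite /c; lra.
have kb : ((1 / 20) `^ b^-1) `^ b = 1 / 20.
  by rewrite -powRrM mulVf ?gt_eqF// powRr1 ?divr_ge0.
have h1 : 1 / 2 <= (2^-1 : R) `^ b.
  rewrite -[X in X <= _](@powRr1 _ (1 / 2)) ?divr_ge0// div1r.
  by apply: ger_powR; [apply/andP; split; lra|rewrite /b; lra].
have g2 : (2^-1 : R) `^ (- c) <= 2.
  apply: (@le_trans _ _ (2^-1 `^ (-1))); last by rewrite powR_inv1 ?invr_ge0// invrK.
  by apply: ger_powR; [apply/andP; split; lra|rewrite /c; lra].
rewrite -/b; have := powR_ge0 (1 / 20 : R) b^-1; move: (_ `^ b^-1) kb => k kb k0.
rewrite /comparison_bound E1 E2 opprK !powRM ?invr_ge0 ?(ltW r0)//.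
rewrite kb (quad_scale r r0) (quad_scale rho rho0) (lin_scale r r0) (lin_scale rho rho0).
rewrite /tail_const -/b -/c.
set P := r `^ _; set Q := rho `^ _; set h := _ `^ b in h1 *; set g := _ `^ (- c) in g2 *.
have P0 : 0 <= P by exact: powR_ge0.
have rn : r != 0 by rewrite gt_eqF.
have rhon : rho != 0 by rewrite gt_eqF.
have bn : b != 0 by rewrite gt_eqF.
have cn : c != 0 by rewrite gt_eqF.
have -> : L * q / r ^+ 2 * (5 / 4 * (1 / 20 * (P * r ^+ 2) / b) -
      1 / 4 * (P * r ^+ 2 * h / b)) + 8 * (L * q) / r * (P * r * g / c) +
    (4 * A / rho ^+ 2 * (Q * rho ^+ 2 / b) + 4 * A / rho * (Q * rho / c)) =
  L * q * P * ((1 / 16 - 1 / 4 * h) * b^-1 + 8 * g * c^-1) + 4 * A * Q * (b^-1 + c^-1).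
  by field; rewrite rn rhon bn cn.
rewrite lerD2r -[leRHS]mulrN1 (ler_wpM2l (mulr_ge0 Lq0 P0))//.
(* The threshold on [s] enters here: the near part is at most [- 1024 / 16 = - 64], against a tail
   of at most 32. *)
have bi : 32 * 32 <= b^-1.
  by rewrite -[leRHS]mul1r (ler_pdivlMr _ _ b0) /b; lra.
have ci : c^-1 <= 2 by rewrite -[leLHS]mul1r (ler_pdivrMr _ _ c0) /c; lra.
have ci0 : 0 <= c^-1 by rewrite invr_ge0 ltW.
have bi0 : 0 <= b^-1 by rewrite invr_ge0 ltW.
have t1 : (1 / 16 - 1 / 4 * h) * b^-1 <= - (1 / 16) * b^-1.
  by apply: ler_wpM2r => //; lra.
have t2 : 8 * g * c^-1 <= 16 * c^-1 by apply: ler_wpM2r => //; lra.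
apply: le_trans (lerD t1 t2) _.
by move: b^-1 c^-1 bi ci {t1 t2 bi0 ci0} => B K B1 K1; lra.
Qed.

(** The part in [M] keeps the maximum inside the ball and absorbs the localization; the part in [F]
    pays for the oscillation of the right-hand side. *)
Definition holder_const (c s M F rho : R) : R :=
  (2 + 8 * tail_const s) * M * rho `^ (- (1 / 4)) + 2 * F / c * rho `^ (2 * s - 1 / 4).

(** The factor 3 arises because [x] is within [rho] of [x0], [y] within [2 * rho], and the ball
    around [y] has radius [|x - y| < rho]. *)
Lemma holder_bound (C : R -> R) (s : R) (Omega : set V) (f u : V -> R) (x0 : V)
    (M F rho : R) : 0 < C s -> 1 - 1 / (32 * 64) < s < 1 ->
  visc_sol C s Omega f u -> (forall z, `|u z| <= M) -> 0 < M -> 0 < rho ->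
  eball x0 (3 * rho) `<=` Omega ->
  (forall z, eball x0 (3 * rho) z -> `|f z| <= F) ->
  forall y, u x0 - u y <= holder_const (C s) s M F rho * enorm (x0 - y) `^ (1 / 4).
Proof.
move=> Cs0 s01 usol uM M0 rho0 OmB fF y1.
have [[bu_ borelu cu] _] := usol.1.
have /andP[s0 s1] := s01.
have F0 : 0 <= F.
  apply: le_trans (fF x0 _); first exact: normr_ge0.
  by rewrite /eball/= subrr enorm0; lra.
have ts0 : 0 < tail_const s by rewrite addr_gt0// invr_gt0; lra.
set L := holder_const _ _ _ _ _.
have rq0 : 0 < rho `^ (- (1 / 4)) by exact: powR_gt0.
have L0 : 0 < L.
  rewrite /L /holder_const ltr_wpDr// ?mulr_ge0 ?powR_ge0 ?invr_ge0 ?(ltW Cs0)//.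
  by rewrite !mulr_gt0//; lra.
have Lrho : 2 * M <= L * rho `^ (1 / 4).
  rewrite -ler_pdivrMr ?powR_gt0// -powRN /L /holder_const.
  have : 0 <= 2 * F / C s * rho `^ (2 * s - 1 / 4).
    by rewrite !mulr_ge0 ?powR_ge0 ?invr_ge0 ?(ltW Cs0).
  have : 0 <= 8 * tail_const s * (M * rho `^ (- (1 / 4))).
    by rewrite !mulr_ge0 ?(ltW ts0) ?(ltW M0) ?(ltW rq0).
  nra.
rewrite -quarter_powR leNgt; apply/negP => y1P.
(* [2 * M] bounds the oscillation of [u], so the doubled function is nonpositive once [x] is at
   distance [rho] or more from [x0]. *)
pose A := 2 * M.
have A0 : 0 <= A by rewrite /A; lra.
pose Phi (p : V * V) := u p.1 - u p.2 - L * quarter (p.1 - p.2) - tquad A rho x0 p.1.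
have PhiP p : 0 < Phi p -> enorm (p.1 - x0) < rho /\ enorm (p.1 - p.2) < rho.
  case: p => x y; rewrite /Phi/= => P0.
  have := uM x; have := uM y; rewrite !ler_norml => /andP[uy1 uy2] /andP[ux1 ux2].
  have q0 : 0 <= L * quarter (x - y) by rewrite mulr_ge0 ?root8_ge0 ?ltW.
  have t0 := tquad_ge0 rho x0 x A0.
  split; rewrite ltNge; apply/negP => h.
    by move: P0; rewrite (tquad_out A rho0 h) /A; lra.
  have : L * rho `^ (1 / 4) <= L * quarter (x - y).
    rewrite ler_pM2l// quarter_powR ge0_ler_powR ?nnegrE ?enorm_ge0 ?(ltW rho0)//.
  by lra.
have tx0 : tquad A rho x0 x0 = 0.
  by rewrite tquad_in// subrr ?sqn0 ?mulr0// enorm0 ltW.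
have Phi1 : 0 < Phi (x0, y1) by rewrite /Phi/= tx0; lra.
pose K := [set z | enorm (z - x0) <= rho] `*` [set z | enorm (z - x0) <= 2 * rho].
have KP p : 0 < Phi p -> K p.
  move=> /PhiP[h1 h2]; split => /=; first exact: ltW.
  by have := ler_enorm_dist p.1 p.2 x0; rewrite (enormB p.2 p.1); lra.
have cK : compact K by apply: compact_setX; exact: compact_cball.
have cuB z : eball x0 (3 * rho) z -> {for z, continuous u}.
  move=> Bz; have := continuous_subspaceW OmB cu.
  by rewrite continuous_open_subspace; [apply; exact/mem_set|exact: open_eball].
have cPhi : {within K, continuous Phi}.
  apply: continuous_in_subspaceT => -[x y] /set_mem[/= Kx Ky].
  have fst_c : {for (x, y), continuous (@fst V V)} by exact: cvg_fst.
  have snd_c : {for (x, y), continuous (@snd V V)} by exact: cvg_snd.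
  have c1 : {for (x, y), continuous (fun p : V * V => u p.1)}.
    by apply: (@continuous_comp _ _ _ fst u) => //; apply: cuB; rewrite /eball/=; lra.
  have c2 : {for (x, y), continuous (fun p : V * V => u p.2)}.
    by apply: (@continuous_comp _ _ _ snd u) => //; apply: cuB; rewrite /eball/=; lra.
  have c3 : {for (x, y), continuous (fun p : V * V => L * quarter (p.1 - p.2))}.
    apply: (@continuousM _ _ (cst L) (fun p : V * V => quarter (p.1 - p.2))).
      exact: cst_continuous.
    apply: (@continuous_comp _ _ _ (fun p : V * V => p.1 - p.2) quarter).
      exact: (@continuousB _ _ _ (@fst V V) (@snd V V)).
    apply: (@continuous_comp _ _ _ sqn root8); first exact: continuous_sqn.
    exact: continuous_root8.
  have c4 : {for (x, y), continuous (fun p : V * V => tquad A rho x0 p.1)}.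
    by apply: (@continuous_comp _ _ _ fst (tquad A rho x0)) => //; exact: continuous_tquad.
  apply: (@continuousB _ _ _ (fun p : V * V => u p.1 - u p.2 - L * quarter (p.1 - p.2))
    (fun p => tquad A rho x0 p.1)) => //.
  apply: (@continuousB _ _ _ (fun p : V * V => u p.1 - u p.2)
    (fun p => L * quarter (p.1 - p.2))) => //.
  exact: (@continuousB _ _ _ (fun p : V * V => u p.1) (fun p => u p.2)).
have K0 : K !=set0 by exists (x0, y1); exact: KP.
have [[x y] /set_mem Kxy maxK] := compact_EVT_max K0 cK cPhi.
have Pxy : 0 < Phi (x, y) by apply: (lt_le_trans Phi1); apply: maxK; apply: mem_set; exact: KP.
(* [Phi] is positive only inside [K], so its positive maximum over [K] is global, as the nonlocal
   comparison requires. *)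
have gmax p : Phi p <= Phi (x, y).
  have [p0|p0] := leP (Phi p) 0; first exact: le_trans p0 (ltW Pxy).
  by apply: maxK; apply: mem_set; exact: KP.
have [/= xx0 xy] := PhiP _ Pxy.
have nxy : x != y.
  apply: contraTneq Pxy => ->; rewrite -leNgt /Phi/= !subrr.
  have -> : quarter (0 : V) = 0.
    by rewrite /quarter sqn0 root80.
  by have := tquad_ge0 rho x0 y A0; lra.
set kap := (1 / 20) `^ (2 - 2 * s)^-1.
have kap01 : 0 < kap < 1 / 2.
  apply/andP; split; first by apply: powR_gt0; lra.
  apply: (@le_lt_trans _ _ ((1 / 20) `^ 1)); last by rewrite powRr1; lra.
  apply: ger_powR; first by apply/andP; split; lra.
  by rewrite -[1]invr1 lef_pV2 ?posrE//; lra.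
have s12 : 1 / 2 < s < 1 by apply/andP; split; lra.
have r0 : 0 < enorm (x - y) by rewrite enorm_gt0// subr_eq0.
have Ox : [set z | enorm (z - x) < enorm (x - y)] `<=` Omega.
  move=> z /= zx; apply: OmB; rewrite /eball/=.
  by have := ler_enorm_dist x z x0; lra.
have Oy : [set z | enorm (z - y) < enorm (x - y)] `<=` Omega.
  move=> z /= zy; apply: OmB; rewrite /eball/=.
  have := ler_enorm_dist y z x0; have := ler_enorm_dist x y x0.
  by rewrite (enormB y x); lra.
have := maximum_point_comparison (ltW L0) A0 rho0 uM borelu (ltW xx0) nxy (ltW xy)
  s12 kap01 (fun x' y' => gmax (x', y')) Cs0 usol Ox Oy.
rewrite leNgt => /negP; apply.
have Lq0 : 0 <= L * quarter (x - y) by rewrite mulr_ge0 ?root8_ge0 ?ltW.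
have := comparison_bound_le A Lq0 r0 rho0 s01; rewrite -/kap.
move=> /(ler_wpM2l (ltW Cs0)) /le_lt_trans; apply.
have fx : - F <= f x.
  have := fF x; rewrite ler_norml => /(_ _)/andP[]//; rewrite /eball/=; lra.
have fy : f y <= F.
  have := fF y; rewrite ler_norml => /(_ _)/andP[]//; rewrite /eball/=.
  by have := ler_enorm_dist x y x0; rewrite (enormB y x); lra.
set Q := rho `^ (- (2 * s)).
have Q0 : 0 < Q by exact: powR_gt0.
(* The exponent [1/4 - 2 s] is negative, so the gain at [|x - y| < rho] is at least the one at scale
   [rho], for which [L] was calibrated. *)
have main : (2 + 8 * tail_const s) * M * Q + 2 * F / C s <=
    L * quarter (x - y) * enorm (x - y) `^ (- (2 * s)).
  have -> : (2 + 8 * tail_const s) * M * Q + 2 * F / C s = L * rho `^ (1 / 4 - 2 * s).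
    have e1 : rho `^ (- (1 / 4)) * rho `^ (1 / 4 - 2 * s) = Q.
      by rewrite -powRD ?(gt_eqF rho0) ?implybT//; congr (_ `^ _); lra.
    have e2 : rho `^ (2 * s - 1 / 4) * rho `^ (1 / 4 - 2 * s) = 1.
      rewrite -powRD ?(gt_eqF rho0) ?implybT// -[RHS](powRr0 rho).
      by congr (_ `^ _); lra.
    have -> : 2 * F / C s =
        2 * F / C s * (rho `^ (2 * s - 1 / 4) * rho `^ (1 / 4 - 2 * s)).
      by rewrite e2 mulr1.
    by rewrite -e1 /L /holder_const; ring.
  rewrite -mulrA ler_pM2l// quarter_powR -powRD ?(gt_eqF r0) ?implybT//.
  by apply: ler_powR_npos => //; [exact: ltW|lra].
have CF : C s * (2 * F / C s) = 2 * F by rewrite mulrC divfK ?gt_eqF.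
(* The term with [8 * tail_const s] cancels the localization cost, [2 * F] covers [f x - f y], and
   [2 * M * Q] leaves a strict inequality. *)
have := ler_wpM2l (ltW Cs0) main; rewrite mulrDr CF.
have : 0 < C s * (M * Q) by rewrite !mulr_gt0.
rewrite /A; lra.
Qed.

End HolderBound.

(** * Uniform radii on compact sets and distance to the boundary *)

Section CompactNeighbourhoods.
Context {R : realType} {N : nat}.
Local Notation V := 'rV[R]_N.
Implicit Types (A B U Omega : set V) (f u : V -> R) (x y z : V).

Lemma open_sub_eball U x : open U -> U x -> exists2 d : R, 0 < d & eball x d `<=` U.
Proof.
move=> oU Ux; have /nbhs_ballP[d d0 dU] : nbhs x U by exact: open_nbhs_nbhs.
exists d => // y xy; apply: dU; rewrite -ball_normE /ball_/=.
by rewrite distrC; exact: le_lt_trans (ler_norm_enorm _) xy.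
Qed.

(** One parameter [d] serves as radius and, through [d^-1], as bound for [f]: both conditions hold
    for all small [d] near each point, and compactness makes this uniform. *)
Lemma uniform_eball A Omega f : compact A -> open Omega -> A `<=` Omega ->
  {within Omega, continuous f} ->
  exists2 d : R, 0 < d & forall x, A x ->
    eball x d `<=` Omega /\ forall z, eball x d z -> `|f z| <= d^-1.
Proof.
move=> /compact_near_coveringP cA oO AO.
rewrite continuous_open_subspace// => cf.
pose P (d : R) x := eball x d `<=` Omega /\ forall z, eball x d z -> `|f z| <= d^-1.
have : \forall d \near 0^'+, A `<=` P d.
  apply: cA => x Ax; have Ox := AO x Ax.
  have fx : \forall z \near x, `|f z| < `|f x| + 1.
    have cnf : {for x, continuous (fun z => `|f z|)}.
      apply: (@continuous_comp _ _ _ f (@Num.norm R R)); last exact: norm_continuous.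
      exact: (cf x (mem_set Ox)).
    by apply: (cvgr_lt _ cnf); lra.
  have [d d0 dO] : exists2 d : R, 0 < d & eball x d `<=`
      [set z | Omega z /\ `|f z| < `|f x| + 1]°.
    apply: open_sub_eball; first exact: open_interior.
    by apply: filterI => //; exact: open_nbhs_nbhs.
  exists (eball x (d / 2), [set e | 0 < e /\ e < Num.min (d / 2) (`|f x| + 1)^-1]) => /=.
    split; first (apply: open_nbhs_nbhs; split; first exact: open_eball).
      by rewrite /eball/= subrr enorm0 divr_gt0.
    near=> e; split; near: e; first exact: nbhs_right_gt.
    apply: nbhs_right_lt; rewrite lt_min divr_gt0// invr_gt0.
    by have := normr_ge0 (f x); lra.
  move=> [x' e] /= [x'x [e0]]; rewrite lt_min => /andP[ed ef].
  have sub z : eball x' e z -> Omega z /\ `|f z| < `|f x| + 1.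
    move=> zx'; suff /dO/interior_subset : eball x d z by [].
    have := ler_enorm_dist x' z x; rewrite /eball/= in x'x zx' *; lra.
  have f0 : 0 < `|f x| + 1 by have := normr_ge0 (f x); lra.
  split=> z /sub[Oz fz] //; apply: le_trans (ltW fz) _.
  by rewrite -[leLHS]invrK lef_pV2 ?posrE ?invr_gt0// ltW.
move=> H; near (0 : R)^'+ => d; exists d.
  by near: d; exact: nbhs_right_gt.
by near: d; exact: H.
Unshelve. all: by end_near. Qed.

(** If the segment missed the boundary, its trace on [A] would be nonempty, relatively open and
    relatively closed, hence everything. *)
Lemma segment_meets_bdry A x y : open A -> A x -> ~ A y ->
  exists2 b, bdry A b & enorm (x - b) <= enorm (x - y).
Proof.
move=> oA Ax Ay; apply: contrapT => nb.
pose g (t : R) : V := x + t *: (y - x).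
have gbd (t : R) : `[0, 1]%classic t -> ~ bdry A (g t).
  rewrite /= in_itv/= => /andP[t0 t1] bt; apply: nb; exists (g t) => //.
  rewrite /g opprD addrA subrr sub0r enormN enormZ ger0_norm// (enormB y x).
  by rewrite ler_piMl// enorm_ge0.
have gA (t : R) : `[0, 1]%classic t -> closure A (g t) -> A (g t).
  move=> t01 cAt; apply: contrapT => nAt; apply: (gbd t t01); split => //.
  by move/interior_subset.
have := @segment_connected R 0 1.
move=> /(_ (`[0, 1]%classic `&` g @^-1` A)) H.
have : `[0, 1]%classic `&` g @^-1` A = `[0, 1]%classic.
  apply: H.
  - by exists 0; split => /=; [rewrite in_itv/= lexx ler01|rewrite /g scale0r addr0].
  - exists (g @^-1` A) => //; apply: open_comp => // t _; exact: continuous_line.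
  - exists (g @^-1` closure A).
      apply: closed_comp; last exact: closed_closure.
      by move=> t _; exact: continuous_line.
    apply/seteqP; split => t [t01 At]; split => //; first exact: subset_closure.
    exact: gA.
move=> E; have : `[0, 1]%classic (1 : R) by rewrite /= in_itv/= ler01 lexx.
by rewrite -E => -[_]; rewrite /g/= scale1r addrC subrK.
Qed.

Lemma compact_notin A : (1 <= N)%N -> compact A -> exists y, ~ A y.
Proof.
move=> N1 cA; have [->|/set0P A0] := eqVneq A set0; first by exists 0.
have [m _ mmax] : exists2 c, c \in A & forall t, t \in A -> enorm t <= enorm c.
  by apply: compact_EVT_max => //; apply: continuous_subspaceT; exact: continuous_enorm.
pose v : V := const_mx 1.
have v0 : 0 < enorm v.
  apply: enorm_gt0; apply/eqP => /rowP/(_ (Ordinal N1)); rewrite !mxE.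
  by apply/eqP; exact: oner_neq0.
exists (((enorm m + 1) / enorm v) *: v) => Av.
have := mmax _ (mem_set Av); rewrite enormZ ger0_norm.
  by rewrite divfK ?gt_eqF//; lra.
by rewrite divr_ge0 ?(ltW v0)// addr_ge0 ?enorm_ge0.
Qed.

(** Since [N >= 1], some point lies outside the compact closure of [B]; a segment towards it meets
    the boundary, so the distance is finite. A point outside [B] cannot be closer than the
    boundary. *)
Lemma set_dist_bdryP A B : (1 <= N)%N -> A !=set0 -> open B -> compactly_in A B ->
  compact (closure B) ->
  exists2 d : R, 0 < d & set_dist A (bdry B) = d%:E /\
    forall x, A x -> eball x d `<=` B.
Proof.
move=> N1 [a Aa] oB [cA AB] cB.
have subB x : A x -> B x by move=> Ax; apply: AB; exact: subset_closure.
have [y nBy] := compact_notin N1 cB.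
have [b bb _] := segment_meets_bdry oB (subB a Aa) (fun By => nBy (subset_closure By)).
(* With the zero function, only the uniform radius is extracted; it bounds the distance from
   below. *)
have [e e0 eP] := @uniform_eball _ _ (cst 0) cA oB AB (fun x => @cst_continuous _ _ _ _).
set D := set_dist A (bdry B).
have De : (e%:E <= D)%E.
  apply: le_ereal_inf_tmp => _ [[x z] /= [Ax [_ nBz]] <-]; rewrite lee_fin leNgt.
  apply/negP => xz; apply: nBz; have [sB _] := eP x (subset_closure Ax).
  rewrite (interior_id _).1//; apply: sB; by rewrite /eball/= enormB.
have Db : (D <= (enorm (a - b))%:E)%E by apply: ereal_inf_lbound; exists (a, b).
have Dfin : D \is a fin_num.
  rewrite fin_numE; apply/andP; split.
    by apply: contraTneq De => ->; rewrite -ltNge ltNyr.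
  by apply: contraTneq Db => ->; rewrite -ltNge ltry.
exists (fine D); first by rewrite -lte_fin fineK//; apply: lt_le_trans De; rewrite lte_fin.
split=> [|x Ax z xz]; first by rewrite fineK.
apply: contrapT => nBz; have [c bc xc] := segment_meets_bdry oB (subB x Ax) nBz.
have : (D <= (enorm (x - c))%:E)%E by apply: ereal_inf_lbound; exists (x, c).
rewrite -[D]fineK// lee_fin leNgt => /negP; apply; apply: le_lt_trans xc _.
by rewrite enormB.
Qed.

Lemma supnorm_bounds A u (m : R) : A !=set0 -> (forall x, A x -> `|u x| <= m) ->
  forall x, A x -> `|u x| <= fine (supnorm A u).
Proof.
move=> [a Aa] um x Ax.
have ub : (supnorm A u <= m%:E)%E.
  by apply: ge_ereal_sup => _ [z Az <-]; rewrite lee_fin um.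
have le z : A z -> (`|u z|%:E <= supnorm A u)%E.
  by move=> Az; apply: ereal_sup_ubound; exists z.
rewrite -lee_fin fineK ?le//; rewrite fin_numE; apply/andP; split.
  by apply: contraTneq (le a Aa) => ->; rewrite -ltNge ltNyr.
by apply: contraTneq ub => ->; rewrite -ltNge ltry.
Qed.

Lemma holder_norm_le A u (M L : R) : (forall x, A x -> `|u x| <= M) ->
  (forall x y, A x -> A y -> u x - u y <= L * enorm (x - y) `^ (1 / 4)) ->
  (holder_norm (1 / 4) A u <= (M + L)%:E)%E.
Proof.
move=> uM uL; rewrite EFinD; apply: leeD.
  by apply: ge_ereal_sup => _ [x Ax <-]; rewrite lee_fin uM.
apply: ge_ereal_sup => _ [[x y] /= [Ax Ay xy] <-].
rewrite lee_fin ler_pdivrMr ?powR_gt0 ?enorm_gt0 ?subr_eq0//.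
by rewrite ler_norml uL// andbT lerNl opprB enormB uL.
Qed.

End CompactNeighbourhoods.

(** * Threshold, local Holder estimate and Liouville property *)

Theorem theorem1p3 (R : realType) (N : nat) (hN : (1 <= N)%N)
    (C : R -> R) (hC : normalizing N C) :
  exists s0 : R, 1 / 2 < s0 < 1 /\
  forall s : R, s0 < s < 1 ->
    (exists alpha : R, 0 < alpha < 1 /\
     exists K : \bar R -> \bar R -> \bar R -> R,
       (forall d a b, 0 < K d a b) /\
       forall (Omega : set 'rV[R]_N) (f u : 'rV[R]_N -> R),
         domain Omega -> {within Omega, continuous f} ->
         visc_sol C s Omega f u ->
         holder_loc alpha Omega u /\
         forall omega omega' : set 'rV[R]_N,
           open omega -> open omega' ->
           compactly_in omega omega' -> compactly_in omega' Omega ->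
           (holder_norm alpha omega u <=
            (K (set_dist omega (bdry omega'))
               (supnorm [set: 'rV[R]_N] u) (supnorm omega' f))%:E)%E) /\
    (forall u : 'rV[R]_N -> R,
       continuous u -> visc_sol C s [set: 'rV[R]_N] (cst 0) u ->
       exists c : R, forall x, u x = c).
Proof.
exists (1 - 1 / (32 * 64)); split; first by apply/andP; split; lra.
move=> s s01; have /andP[s0 s1] := s01.
have Cs0 : 0 < C s by apply: hC.1; apply/andP; split; lra.
have ubound u : bounded_on_space u -> exists M : R, forall z : 'rV[R]_N, `|u z| <= M.
  by move=> [m [_ mu]]; exists (m + 1) => z; apply: mu => //; rewrite ltrDl.
have third (d : R) : 3 * (d / 3) = d by rewrite mulrC divfK.
split.
- exists (1 / 4); split; first by apply/andP; split; lra.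
  (* Adding 1 gives a positive bound on [u] even when [u = 0], absolute values keep the constant
     positive for all arguments, and [fine d / 3] fits the ball of radius [3 * rho]. *)
  exists (fun d a b => `|fine a| + 1 +
    `|holder_const (C s) s (`|fine a| + 1) (fine b) (fine d / 3)|).
  split=> [d a b|Omega f u [_ oO _] cf usol].
    by rewrite ltr_pwDl// ltr_wpDl.
  have [[/ubound[m um] _ _] _] := usol.1.
  split=> [om oom [com omO]|om om' oom oom' omom' om'O].
    have [d d0 dP] := uniform_eball com oO omO cf.
    have um' z : `|u z| <= `|m| + 1.
      by apply: le_trans (um z) _; have := ler_norm m; lra.
    have m0 : 0 < `|m| + 1 by have := normr_ge0 m; lra.
    apply: le_lt_trans (ltry (`|m| + 1 + holder_const (C s) s (`|m| + 1) d^-1 (d / 3))).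
    apply: holder_norm_le => // x y omx _.
    have [sO fd] := dP x (subset_closure omx).
    by apply: holder_bound usol um' m0 _ _ _ _ => //; rewrite ?divr_gt0 ?third.
  set a := supnorm setT u; set b := supnorm om' f; set d := set_dist om _.
  have ua z : `|u z| <= `|fine a| + 1.
    apply: (@le_trans _ _ (fine a)); last by have := ler_norm (fine a); lra.
    by apply: supnorm_bounds (fun z _ => um z) _ _ => //; exists 0.
  have a0 : 0 < `|fine a| + 1 by have := normr_ge0 (fine a); lra.
  set H := holder_const _ _ _ _ _.
  apply: (@le_trans _ _ (`|fine a| + 1 + H)%:E); last first.
    by rewrite lee_fin lerD2l ler_norm.
  apply: holder_norm_le => // x y omx _; rewrite /H {H}.
  have [e e0 [de eP]] := set_dist_bdryP hN (ex_intro _ x omx) oom' omom' om'O.1.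
  rewrite /d de/=.
  have [e' e'0 fe'] := uniform_eball om'O.1 oO om'O.2 cf.
  have om'x : om' x by apply: omom'.2; exact: subset_closure.
  have fb z : om' z -> `|f z| <= fine b.
    apply: (@supnorm_bounds _ _ _ _ e'^-1); first by exists x.
    move=> w om'w; have [_] := fe' w (subset_closure om'w); apply.
    by rewrite /eball/= subrr enorm0.
  apply: holder_bound usol ua a0 _ _ _ _ => //; rewrite ?divr_gt0 ?third//.
    by apply: subset_trans (eP x omx) _ => z om'z; apply: om'O.2; exact: subset_closure.
  by move=> z /(eP x omx); exact: fb.
- move=> u cu usol; have [[/ubound[m um] _ _] _] := usol.1.
  have um' z : `|u z| <= `|m| + 1.
    by apply: le_trans (um z) _; have := ler_norm m; lra.
  have m0 : 0 < `|m| + 1 by have := normr_ge0 m; lra.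
  have ule x y : u x <= u y.
    rewrite leNgt; apply/negP => uxy.
    pose c := (2 + 8 * tail_const s) * (`|m| + 1).
    (* On the whole space every radius is allowed and [F = 0], so the bound decays like
       [rho ^ (- 1/4)]. *)
    have bound (rho : R) : 0 < rho ->
        u x - u y <= c * enorm (x - y) `^ (1 / 4) * rho `^ (- (1 / 4)).
      move=> rho0; have := @holder_bound _ _ C s setT (cst 0) u x (`|m| + 1) 0 rho
        Cs0 s01 usol um' m0 rho0 _ _ y.
      rewrite /holder_const mulr0 !mul0r addr0 mulrAC; apply => // z _.
      by rewrite normr0.
    have : c * enorm (x - y) `^ (1 / 4) * rho `^ (- (1 / 4)) @[rho --> +oo%R] -->
        c * enorm (x - y) `^ (1 / 4) * 0.
      by apply: cvgM; [exact: cvg_cst|apply: powR_cvgy0; lra].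
    rewrite mulr0 => /cvgr_lt/(_ (u x - u y)); rewrite subr_gt0 => /(_ uxy) small.
    near (pinfty_nbhs R) => rho.
    have := bound rho; rewrite leNgt => /(_ _)/negP; apply.
      by near: rho; exact: nbhs_pinfty_gt.
    by near: rho.
  by exists (u 0) => x; apply/eqP; rewrite eq_le !ule.
Unshelve. all: by end_near. Qed.
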